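(* Let $\gamma=\gamma(a_0,a_1)$ be a Jordan arc in $\mathbb R^2$ with endpoints $a_0,a_1$ such that: (i) for any $\varepsilon>0$ and for any non-degenerate subarc $\gamma'\subset\gamma$ there is an affine map $S$ such that $S(\gamma)\subset\gamma'$ and $\operatorname{Lip} S<\varepsilon$; (ii) there is a sequence of affine maps $f_k$ converging to the identity map $\mathrm{Id}$ such that $f_k(\gamma)\cap\gamma=\gamma(f_k(a_0),a_1)$ and $\operatorname{fix}(f_k)\cap\gamma=\varnothing$. Then $\gamma$ is a parabolic segment.
   Context: All affine maps are maps of $\mathbb R^2$ to itself. For points $x,y$ of a Jordan arc $\gamma$, $\gamma(x,y)$ denotes the subarc of $\gamma$ with endpoints $x$ and $y$ (so the equality in (ii) includes that $f_k(a_0)\in\gamma$). $\operatorname{Lip}S$ is the Lipschitz constant of $S$, and $\operatorname{fix}(f)$ is the set of fixed points of $f$. A parabolic segment is a segment (subarc) of a parabola or a straight line segment.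
   Formalization: In (i) the affine map S is required to be non-constant; if constant maps are allowed, (i) holds for every arc and a short circular arc, with f_k small rotations about its centre, is a counterexample. *)

(* Defs.v *)
(* The plane is represented by 'rV[R]_2 for R : realType. *)
From HB Require Import structures.
From mathcomp Require Import all_boot all_order all_algebra.
From mathcomp Require Import all_classical all_reals all_analysis.
Set Implicit Arguments.
Unset Strict Implicit.
Unset Printing Implicit Defensive.
Import Order.TTheory GRing.Theory Num.Theory.
Import numFieldNormedType.Exports.
Local Open Scope classical_set_scope.
Local Open Scope ring_scope.

(* The library norm `|x| on 'rV[R]_2 is the sup norm; it induces the same
   topology, but Lipschitz constants and distances below are Euclidean. *)
Definition enorm (R : realType) (x : 'rV[R]_2) : R :=
  Num.sqrt (\sum_(i < 2) x ord0 i ^+ 2).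

Definition affine_map (R : realType) (S : 'rV[R]_2 -> 'rV[R]_2) : Prop :=
  exists (A : 'M[R]_2) (b : 'rV[R]_2), forall x, S x = x *m A + b.

(* Constant maps must be excluded from the affine maps S with
   S(gamma) contained in a given subarc and Lip S < eps: with them this
   condition holds for every arc, and a circular arc, with f_k small rotations
   about its centre, would be a counterexample to the theorem. Singular
   non-constant maps are harmless and stay allowed. *)
Definition nonconstant (T U : Type) (S : T -> U) : Prop :=
  exists x y, S x <> S y.

Definition Lip (R : realType) (S : 'rV[R]_2 -> 'rV[R]_2) : \bar R :=
  ereal_sup [set (enorm (S p.1 - S p.2) / enorm (p.1 - p.2))%:E
            | p in [set p : 'rV[R]_2 * 'rV[R]_2 | p.1 <> p.2]].

Definition fix_set (T : Type) (f : T -> T) : set T := [set x | f x = x].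

(* By compactness of [0, 1], phi is a homeomorphism onto its image gamma. *)
Definition arc_param (R : realType) (phi : R -> 'rV[R]_2)
    (gamma : set 'rV[R]_2) : Prop :=
  [/\ {within `[0, 1], continuous phi},
      set_inj `[0, 1] phi
    & phi @` `[0, 1] = gamma].

Definition jordan_arc (R : realType) (gamma : set 'rV[R]_2)
    (a0 a1 : 'rV[R]_2) : Prop :=
  exists phi : R -> 'rV[R]_2,
    [/\ arc_param phi gamma, phi 0 = a0 & phi 1 = a1].

(* sigma = gamma(x, y); in particular x and y lie on gamma. The choice of phi
   is immaterial, and s <= t is no restriction on the pair x, y because phi
   may be reversed. The case x = y gives the degenerate subarc [set x]. *)
Definition is_subarc (R : realType) (gamma : set 'rV[R]_2)
    (x y : 'rV[R]_2) (sigma : set 'rV[R]_2) : Prop :=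
  exists (phi : R -> 'rV[R]_2) (s t : R),
    [/\ arc_param phi gamma, 0 <= s <= t /\ t <= 1,
        phi s = x, phi t = y & sigma = phi @` `[s, t]].

Definition edist_set (R : realType) (z : 'rV[R]_2) (L : set 'rV[R]_2) : R :=
  inf [set enorm (z - w) | w in L].

Definition is_line (R : realType) (L : set 'rV[R]_2) : Prop :=
  exists p u : 'rV[R]_2, u != 0 /\ L = range (fun t : R => p + t *: u).

Definition is_parabola (R : realType) (P : set 'rV[R]_2) : Prop :=
  exists (F : 'rV[R]_2) (L : set 'rV[R]_2),
    [/\ is_line L, ~ L F & P = [set z | enorm (z - F) = edist_set z L]].

Definition is_segment (R : realType) (sigma : set 'rV[R]_2) : Prop :=
  exists a b : 'rV[R]_2,
    a <> b /\ sigma = (fun t : R => (1 - t) *: a + t *: b) @` `[0, 1].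

Definition is_parabola_subarc (R : realType) (sigma : set 'rV[R]_2) : Prop :=
  (exists a b, jordan_arc sigma a b) /\
  exists P, is_parabola P /\ sigma `<=` P.

Definition parabolic_segment (R : realType) (sigma : set 'rV[R]_2) : Prop :=
  is_parabola_subarc sigma \/ is_segment sigma.

(* Main.v *)
Require Import Defs.
From HB Require Import structures.
From mathcomp Require Import all_boot all_order all_algebra.
From mathcomp Require Import all_classical all_reals all_analysis.
From mathcomp Require Import ring lra.
Import Order.TTheory GRing.Theory Num.Theory.
Import numFieldNormedType.Exports.
Local Open Scope classical_set_scope.
Local Open Scope ring_scope.
Set Implicit Arguments.
Unset Strict Implicit.
Unset Printing Implicit Defensive.

(** Write [f_k = id + F_k] with [F_k] a small affine vector field, and suppose
    that [gamma] lies on no line. Up to a subsequence the normalised fields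
    [F_k / |F_k|] converge to an affine field [V], which does not vanish on all of
    [gamma]; so on some subarc [gamma'] the map [f_k] moves points by a definite
    fraction of [|F_k|].

    Take [S] as in (i) with linear part [A], mapping [gamma] into [gamma'], and
    conjugate: [S^-1 f_k S] is again close to the identity for large [k], and
    slides [gamma] along itself away from its ends, because [f_k] slides the
    subarc [S gamma] along [gamma]. Its displacement [U] has size at least of
    order [|F_k| / |A|], but the linear part of [U] is similar to that of [F_k].
    Hence the trace and the determinant of the linear part of [U / |U|] tend to
    zero with [|A|] ([renormalised_shift]), and any limit [W] of such normalised
    displacements is an affine field whose linear part [M] has square zero
    ([renormalised_limit_field]).

    The orbit of [W] through a point [q] is the quadratic curve
    [q + t W(q) + t^2/2 W(q) M]. Iterating the conjugated shifts is an Euler scheme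
    for [W] whose iterates stay on [gamma], so [gamma], being closed, contains a
    piece of that orbit ([arc_contains_orbit]). By (i) some affine [S] maps [gamma]
    into this piece, whence [gamma] lies on an affine image of a parabola or of a
    line.

    The argument inverts [S]. If [S] is singular and not constant on [gamma], then
    [gamma] contains a line segment, and in that case [gamma] is a segment
    ([straight_subarc_collinear]): a fixed-point-free shift near the identity
    preserves the line of that segment, and moves every point forward along
    [gamma], so the set of points of [gamma] on this line grows in both
    directions until it is all of [gamma]. *)

(** * Jordan arcs *)

Definition clamp (R : realType) (a b t : R) : R := Num.max a (Num.min b t).

Lemma clamp_itv (R : realType) (a b t : R) : a <= b -> a <= clamp a b t <= b.
Proof.
by move=> ab; rewrite /clamp le_max lexx /= ge_max ab ge_min lexx.
Qed.

Lemma clampE (R : realType) (a b t : R) : a <= t <= b -> clamp a b t = t.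
Proof. by case/andP=> at_ tb; rewrite /clamp (min_idPr tb) (max_idPr at_). Qed.

Lemma clamp_dist (R : realType) (a b s t : R) :
  `|clamp a b s - clamp a b t| <= `|s - t|.
Proof.
rewrite /clamp; have := ler_norm (s - t); have := ler_norm (t - s).
rewrite [X in _ <= X -> _]distrC ler_norml => ? ?.
have [bs|bs] := leP b s; have [bt|bt] := leP b t;
  rewrite !maxElt; do 2?case: ltP => ?; apply/andP; split; lra.
Qed.

Lemma continuous_clamp (R : realType) (a b : R) : continuous (clamp a b).
Proof.
move=> x; apply/cvgrPdist_lt => e e0; near=> y.
apply: (le_lt_trans (clamp_dist _ _ _ _)); near: y.
exact: cvgr_dist_lt.
Unshelve. all: by end_near. Qed.

Lemma continuous_comp_clamp (R : realType) (T : topologicalType) (f : R -> T)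
    (a b : R) : a <= b -> {within `[a, b], continuous f} ->
  continuous (f \o clamp a b).
Proof.
move=> ab /subspace_continuousP cf x.
have xab : `[a, b]%classic (clamp a b x) by rewrite /= in_itv /= clamp_itv.
move=> U /(cf _ xab) nU; have := @continuous_clamp R a b x _ nU.
apply: (@filterS _ (nbhs x)) => y; apply.
by rewrite /= in_itv /= clamp_itv.
Qed.

(** A parametrisation that is continuous on the whole line spares every later
    continuity argument the restriction to the unit interval. *)
Definition arc_on (R : realType) (phi : R -> 'rV[R]_2) (gamma : set 'rV[R]_2) :=
  [/\ continuous phi, set_inj `[0, 1] phi & phi @` `[0, 1] = gamma].

Lemma arc_param_on (R : realType) (phi : R -> 'rV[R]_2) (gamma : set 'rV[R]_2) :
  arc_param phi gamma ->
  exists2 phi', arc_on phi' gamma & forall t, 0 <= t <= 1 -> phi' t = phi t.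
Proof.
case=> cphi iphi im.
have E t : 0 <= t <= 1 -> (phi \o clamp 0 1) t = phi t.
  by move=> t01; rewrite /= clampE.
exists (phi \o clamp 0 1) => //; split.
- exact: continuous_comp_clamp.
- move=> s t; rewrite !inE /= !in_itv /= => s01 t01.
  by rewrite !clampE //; apply: iphi; rewrite inE /= in_itv.
- rewrite -im; apply/seteqP; split=> z [t /= t01 <-];
    by exists t => //=; rewrite clampE //; rewrite in_itv in t01.
Qed.

Lemma arc_on_param (R : realType) (phi : R -> 'rV[R]_2) (gamma : set 'rV[R]_2) :
  arc_on phi gamma -> arc_param phi gamma.
Proof. by case=> *; split=> //; exact: continuous_subspaceT. Qed.

Lemma arc_mem (R : realType) (phi : R -> 'rV[R]_2) (gamma : set 'rV[R]_2) t :
  arc_on phi gamma -> 0 <= t <= 1 -> gamma (phi t).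
Proof. by case=> _ _ <- t01; exists t => //=; rewrite in_itv. Qed.

Lemma arc_memP (R : realType) (phi : R -> 'rV[R]_2) (gamma : set 'rV[R]_2) z :
  arc_on phi gamma -> gamma z -> exists2 t, 0 <= t <= 1 & phi t = z.
Proof.
by case=> _ _ <- [t /= t01 <-]; exists t => //; rewrite in_itv /= in t01.
Qed.

Lemma arc_inj (R : realType) (phi : R -> 'rV[R]_2) (gamma : set 'rV[R]_2) s t :
  arc_on phi gamma -> 0 <= s <= 1 -> 0 <= t <= 1 -> phi s = phi t -> s = t.
Proof. by case=> _ iphi _ s01 t01; apply: iphi; rewrite inE /= in_itv. Qed.

(** Uniform continuity of the inverse of the parametrisation, by compactness of
    the set of pairs of parameters at distance at least [eta]. *)
Lemma arc_inv_unif (R : realType) (phi : R -> 'rV[R]_2) (gamma : set 'rV[R]_2) :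
  arc_on phi gamma -> forall eta, 0 < eta -> exists2 rho, 0 < rho &
    forall s t, 0 <= s <= 1 -> 0 <= t <= 1 -> `|phi s - phi t| < rho ->
      `|s - t| < eta.
Proof.
move=> arc eta eta0; have [cphi _ _] := arc.
pose K := [set p : R * R | (`[0, 1]%classic `*` `[0, 1]%classic) p /\
            eta <= `|p.1 - p.2| ].
have [[p Kp]|K0] := pselect (exists p, K p); last first.
  exists 1 => // s t s01 t01 _; rewrite ltNge; apply/negP => st.
  by apply: K0; exists (s, t); split=> //=; split; rewrite /= in_itv.
have cI : compact (`[0%R, 1%R]%classic `*` `[0%R, 1%R]%classic : set (R * R)).
  by apply: compact_setX; exact: segment_compact.
have cK : compact K.
  apply: (subclosed_compact _ cI); last by move=> q [].
  apply: closedI; first by apply: compact_closed => //; exact: norm_hausdorff.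
  apply: (@preimage_closed _ _ (fun p : R * R => `|p.1 - p.2|) [set x | eta <= x]);
    last exact: closed_ge.
  by move=> q _; apply: cvg_norm; apply: cvgB; [exact: cvg_fst|exact: cvg_snd].
have cf : continuous (fun p : R * R => `|phi p.1 - phi p.2|).
  move=> q; apply: cvg_norm; apply: cvgB.
    by apply: (@cvg_comp _ _ _ fst phi); [exact: cvg_fst|exact: cphi].
  by apply: (@cvg_comp _ _ _ snd phi); [exact: cvg_snd|exact: cphi].
have [q qK qmin] := compact_EVT_min (ex_intro _ p Kp) cK (continuous_subspaceT cf).
move: qK; rewrite inE => -[[/= q1 q2] qe].
exists (`|phi q.1 - phi q.2|).
  rewrite normr_gt0 subr_eq0; apply/eqP => E.
  rewrite in_itv /= in q1; rewrite in_itv /= in q2.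
  by move: qe; rewrite (arc_inj arc q1 q2 E) subrr normr0 leNgt eta0.
move=> s t s01 t01; rewrite ltNge => H; rewrite ltNge; apply: contra H => st.
by apply: (qmin (s, t)); rewrite inE; split=> //=; split; rewrite /= in_itv.
Qed.

Lemma arc_lift (R : realType) (phi : R -> 'rV[R]_2) (gamma : set 'rV[R]_2)
    (h : R -> 'rV[R]_2) :
  arc_on phi gamma -> continuous h -> (forall u, gamma (h u)) ->
  exists2 theta : R -> R, continuous theta &
    forall u, 0 <= theta u <= 1 /\ phi (theta u) = h u.
Proof.
move=> arc ch hg.
have /choice[theta Ht] : forall u, exists t, 0 <= t <= 1 /\ phi t = h u.
  by move=> u; have [t t01 tE] := arc_memP arc (hg u); exists t.
exists theta => // x; apply/cvgrPdist_lt => e e0.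
have [rho rho0 H] := arc_inv_unif arc e0.
have /cvgrPdist_lt /(_ _ rho0) nh := ch x.
near=> y; apply: H; [exact: (Ht x).1|exact: (Ht y).1|].
rewrite (Ht x).2 (Ht y).2; near: y.
exact: nh.
Unshelve. all: by end_near. Qed.

Lemma itv01_0 (R : realType) : ((0 : R) <= (0 : R)) && ((0 : R) <= (1 : R)).
Proof. by rewrite lexx ler01. Qed.

Lemma itv01_1 (R : realType) : ((0 : R) <= (1 : R)) && ((1 : R) <= (1 : R)).
Proof. by rewrite lexx ler01. Qed.

Lemma IVT_between (R : realType) (f : R -> R) (a b v : R) :
  a <= b -> continuous f -> (f a <= v <= f b) || (f b <= v <= f a) ->
  exists2 c, a <= c <= b & f c = v.
Proof.
move=> ab cf H.
have [|c] := @IVT R f a b v ab (continuous_subspaceT cf).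
  by rewrite ge_min le_max; case/orP: H => /andP[-> ->]; rewrite ?orbT.
by rewrite in_itv /=; exists c.
Qed.

(** A path inside an arc runs through every point of the arc between its two
    ends. *)
Lemma arc_IVT (R : realType) (phi : R -> 'rV[R]_2) (gamma : set 'rV[R]_2)
    (h : R -> 'rV[R]_2) (a b s t v : R) :
  arc_on phi gamma -> continuous h -> a <= b ->
  (forall u, a <= u <= b -> gamma (h u)) ->
  0 <= s <= 1 -> 0 <= t <= 1 -> phi s = h a -> phi t = h b ->
  (s <= v <= t) || (t <= v <= s) -> exists2 u, a <= u <= b & h u = phi v.
Proof.
move=> arc ch ab hg s01 t01 sa tb sv.
have [|u|theta ctheta tP] := @arc_lift R phi gamma (h \o clamp a b) arc.
- by move=> x; apply: continuous_comp; [exact: continuous_clamp|exact: ch].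
- by apply: hg; exact: clamp_itv.
have ta : theta a = s.
  apply: (arc_inj arc) => //; first exact: (tP a).1.
  by rewrite (tP a).2 sa /= clampE // lexx.
have tb' : theta b = t.
  apply: (arc_inj arc) => //; first exact: (tP b).1.
  by rewrite (tP b).2 tb /= clampE // lexx andbT.
have [|u uab uv] := @IVT_between R theta a b v ab ctheta.
  by rewrite ta tb'.
by exists u => //; rewrite -uv (tP u).2 /= clampE.
Qed.


Lemma arc_closed (R : realType) (phi : R -> 'rV[R]_2) (gamma : set 'rV[R]_2) x :
  arc_on phi gamma ->
  (forall e, 0 < e -> exists2 y, gamma y & `|x - y| < e) -> gamma x.
Proof.
case=> cphi _ <- H.
have cl : closed (phi @` `[0, 1]).
  apply: compact_closed; first exact: norm_hausdorff.
  apply: continuous_compact; last exact: segment_compact.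
  exact: continuous_subspaceT.
apply: cl => U /nbhs_ballP[e e0 eU].
by have [y gy xy] := H e e0; exists y; split=> //; apply: eU; rewrite -ball_normE.
Qed.

(** * Lines and parabolas *)

Lemma ord2P (i : 'I_2) : i = 0 \/ i = 1.
Proof. by case: i => [[|[|//]]] H; [left|right]; apply: val_inj. Qed.

Lemma row2P (R : realType) (u v : 'rV[R]_2) :
  u 0 0 = v 0 0 -> u 0 1 = v 0 1 -> u = v.
Proof.
move=> h0 h1; apply/rowP => i.
by case: (ord2P i) => ->.
Qed.

Lemma mulmx2E (R : realType) m n (A : 'M[R]_(m, 2)) (B : 'M[R]_(2, n)) i j :
  (A *m B) i j = A i 0 * B 0 j + A i 1 * B 1 j.
Proof.
rewrite mxE !big_ord_recl big_ord0 addr0.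
by congr (_ * _ + A i _ * B _ j); apply: val_inj.
Qed.

Definition dot (R : realType) (u v : 'rV[R]_2) : R := u 0 0 * v 0 0 + u 0 1 * v 0 1.

Lemma enormE (R : realType) (u : 'rV[R]_2) : enorm u = Num.sqrt (dot u u).
Proof.
rewrite /enorm /dot !big_ord_recl big_ord0 addr0 !expr2.
by congr (Num.sqrt (_ + u 0 _ * u 0 _)); apply: val_inj.
Qed.

Lemma dot_gt0 (R : realType) (u : 'rV[R]_2) : u != 0 -> 0 < dot u u.
Proof.
move=> u0; rewrite lt_neqAle addr_ge0 -?expr2 ?sqr_ge0 // andbT eq_sym.
apply: contra u0; rewrite /dot -!expr2 paddr_eq0 ?sqr_ge0 // !sqrf_eq0.
by case/andP=> /eqP h0 /eqP h1; apply/eqP/row2P; rewrite ?h0 ?h1 mxE.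
Qed.

Lemma orth_proportional (R : realType) (a b c d n m : R) :
  a * n + b * m = 0 -> c * n + d * m = 0 -> n != 0 \/ m != 0 -> a * d = b * c.
Proof.
move=> e1 e2 [] nn; apply: (mulIf nn); apply: subr0_eq.
  by transitivity (d * (a * n + b * m) - b * (c * n + d * m));
    [ring|rewrite e1 e2 !mulr0 subr0].
by transitivity (a * (c * n + d * m) - c * (a * n + b * m));
  [ring|rewrite e1 e2 !mulr0 subr0].
Qed.

Lemma cV2_neq0 (R : realType) (n : 'cV[R]_2) : n != 0 -> n 0 0 != 0 \/ n 1 0 != 0.
Proof.
move=> n0; case: (eqVneq (n 0 0) 0) => [h0|]; last by left.
right; apply: contra n0 => /eqP h1; apply/eqP/matrixP => i j.
by rewrite (ord1 j) mxE; case: (ord2P i) => ->.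
Qed.

(** [collinear] sets lie on the zero set of a nonzero affine functional: in
    this form the preimage of a line under an affine map is immediate. *)
Definition collinear (R : realType) (X : set 'rV[R]_2) : Prop :=
  exists (n : 'cV[R]_2) (d : 'M[R]_1), n != 0 /\ forall z, X z -> z *m n = d.

Lemma collinear_arc_segment (R : realType) (phi : R -> 'rV[R]_2)
    (gamma : set 'rV[R]_2) :
  arc_on phi gamma -> collinear gamma -> is_segment gamma.
Proof.
move=> arc [n [d [n0 nd]]].
have g0 := arc_mem arc (itv01_0 R); have g1 := arc_mem arc (itv01_1 R).
pose a := phi 0; pose w := phi 1 - a.
have w0 : w != 0.
  rewrite subr_eq0; apply/eqP => E.
  by have := oner_neq0 R; rewrite (arc_inj arc (itv01_1 R) (itv01_0 R) E) eqxx.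
have ww := dot_gt0 w0.
pose c z := dot (z - a) w / dot w w.
have zE z : gamma z -> z = a + c z *: w.
  move=> gz.
  have e1 : (z - a) *m n = 0 by rewrite mulmxBl !nd ?subrr.
  have e2 : w *m n = 0 by rewrite mulmxBl !nd ?subrr.
  move: e1 e2 => /matrixP/(_ 0 0) + /matrixP/(_ 0 0).
  rewrite !mulmx2E [RHS]mxE => e1; rewrite [RHS]mxE => e2.
  have det := orth_proportional e1 e2 (cV2_neq0 n0).
  have ww' : dot w w != 0 by rewrite gt_eqF.
  rewrite -[LHS](subrK a) [LHS]addrC; congr (_ + _).
  apply: row2P; rewrite [RHS]mxE; apply: (mulIf ww'); rewrite /c mulrAC divfK //;
    rewrite /dot; apply: subr0_eq.
  - transitivity (w 0 1 * ((z - a) 0 0 * w 0 1 - (z - a) 0 1 * w 0 0)); first by ring.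
    by rewrite det subrr mulr0.
  - transitivity (- w 0 0 * ((z - a) 0 0 * w 0 1 - (z - a) 0 1 * w 0 0)); first by ring.
    by rewrite det subrr mulr0.
have c0 : c a = 0 by rewrite /c subrr /dot !mxE !mul0r addr0 mul0r.
have c1 : c (phi 1) = 1 by rewrite /c divff // gt_eqF.
have cc : continuous (fun t => c (phi t)).
  have [cphi _ _] := arc; move=> t; rewrite /c /dot.
  apply: cvgM; last exact: cvg_cst.
  by apply: cvgD; (apply: cvgM; last exact: cvg_cst);
    apply: (@continuous_comp _ _ _ (fun t => phi t - a) (fun z : 'rV[R]_2 => z 0 _));
    try exact: coord_continuous;
    apply: cvgB; [exact: cphi|exact: cvg_cst|exact: cphi|exact: cvg_cst].
have zeq z z' : gamma z -> gamma z' -> c z = c z' -> z = z'.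
  by move=> gz gz' E; rewrite (zE z) // (zE z') // E.
exists a, (phi 1); split.
  by apply/eqP; rewrite eq_sym -subr_eq0.
have segE t : (1 - t) *: a + t *: phi 1 = a + t *: w.
  by rewrite /w scalerBr scalerBl scale1r -addrA [- _ + _]addrC.
apply/seteqP; split=> z.
  move=> gz; exists (c z); last by rewrite segE -zE.
  rewrite /= in_itv /=; have [s s01 sz] := arc_memP arc gz; rewrite -sz.
  have [s0 s1] := andP s01.
  (* a value outside the unit interval would make one of the two end values
     occur twice *)
  apply/andP; split; rewrite leNgt; apply/negP => H.
    have [|u /andP[su u1] cu] := @IVT_between R (fun t => c (phi t)) s 1 0 s1 cc.
      by rewrite c1 ler01 (ltW H).
    have E : phi u = a.
      apply: zeq => //; last by rewrite cu c0.
      by apply: (arc_mem arc); rewrite u1 (le_trans s0 su).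
    have u0 := arc_inj arc _ (itv01_0 R) E.
    have : s = 0 by apply/eqP; rewrite eq_le s0 -[leRHS]u0 ?su // u1 (le_trans s0).
    by move=> sE; move: H; rewrite sE -/a c0 ltxx.
  have [|u /andP[u0 us] cu] := @IVT_between R (fun t => c (phi t)) 0 s 1 s0 cc.
    by rewrite -/a c0 ler01 (ltW H).
  have u01 : 0 <= u <= 1 by rewrite u0 (le_trans us s1).
  have E : phi u = phi 1.
    apply: zeq => //; last by rewrite cu c1.
    exact: (arc_mem arc).
  have uE := arc_inj arc u01 (itv01_1 R) E.
  have : s = 1 by apply/eqP; rewrite eq_le s1 -[leLHS]uE us.
  by move=> sE; move: H; rewrite sE c1 ltxx.
case=> t /=; rewrite in_itv /= segE => t01 <-.
have [|u u01 cu] := @IVT_between R (fun t => c (phi t)) 0 1 t ler01 cc.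
  by rewrite -/a c0 c1 t01.
by have gu := arc_mem arc u01; rewrite -cu -zE.
Qed.

Lemma inf_attained (R : realType) (E : set R) m :
  E m -> lbound E m -> inf E = m.
Proof.
move=> Em lm; apply/eqP; rewrite eq_le; apply/andP; split.
  by apply: ge_inf => //; exists m.
by apply: lb_le_inf => //; exists m.
Qed.

(** A curve [s |-> p + s u + s^2 v] with [u] orthogonal to [v] has its vertex at
    [p], its axis along [v], and focal distance
    [|u|^2 / (4 |v|)]. *)
Lemma parabola_of_orthogonal (R : realType) (p u v : 'rV[R]_2) :
  u != 0 -> v != 0 -> dot u v = 0 ->
  exists2 P, is_parabola P & forall s, P (p + s *: u + s ^+ 2 *: v).
Proof.
move=> u0 v0 uv; have uu := dot_gt0 u0; have vv := dot_gt0 v0.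
pose k := dot u u / (4 * dot v v).
have k0 : 0 < k by rewrite divr_gt0 // mulr_gt0.
have kE : 4 * k * dot v v = dot u u.
  by rewrite /k mulrAC mulrCA mulfV ?mulr1 // gt_eqF // mulr_gt0.
pose F := p + k *: v.
pose L := range (fun t : R => (p - k *: v) + t *: u).
exists [set z | enorm (z - F) = edist_set z L].
  exists F, L; split=> //; first by exists (p - k *: v), u.
  move=> [t _] /rowP E; have E0 := E 0; have E1 := E 1.
  rewrite !mxE in E0 E1.
  have e0 : t * u 0 0 = 2 * k * v 0 0 by lra.
  have e1 : t * u 0 1 = 2 * k * v 0 1 by lra.
  have : 2 * k * dot v v = t * dot u v.
    transitivity ((2 * k * v 0 0) * v 0 0 + (2 * k * v 0 1) * v 0 1).
      by rewrite /dot; ring.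
    by rewrite -e0 -e1 /dot; ring.
  by rewrite uv mulr0 => /eqP; rewrite mulf_eq0 (gt_eqF vv) mulf_eq0 (gt_eqF k0) /= pnatr_eq0.
move=> s /=.
have -> : enorm (p + s *: u + s ^+ 2 *: v - F) = (s ^+ 2 + k) * enorm v.
  rewrite !enormE -[s ^+ 2 + k]ger0_norm ?addr_ge0 ?sqr_ge0 ?ltW //.
  rewrite -sqrtr_sqr -sqrtrM ?sqr_ge0 //; congr Num.sqrt.
  transitivity (s ^+ 2 * dot u u + 2 * s * (s ^+ 2 - k) * dot u v
                + (s ^+ 2 - k) ^+ 2 * dot v v).
    by rewrite /dot !mxE; ring.
  by rewrite uv -kE; ring.
have dE t : enorm (p + s *: u + s ^+ 2 *: v - (p - k *: v + t *: u)) =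
    Num.sqrt ((s - t) ^+ 2 * dot u u + (s ^+ 2 + k) ^+ 2 * dot v v).
  rewrite enormE; congr Num.sqrt.
  transitivity ((s - t) ^+ 2 * dot u u + 2 * (s - t) * (s ^+ 2 + k) * dot u v
                + (s ^+ 2 + k) ^+ 2 * dot v v).
    by rewrite /dot !mxE; ring.
  by rewrite uv mulr0 addr0.
have mE : (s ^+ 2 + k) * enorm v = Num.sqrt ((s ^+ 2 + k) ^+ 2 * dot v v).
  by rewrite sqrtrM ?sqr_ge0 // sqrtr_sqr ger0_norm ?enormE // addr_ge0 ?sqr_ge0 ?ltW.
apply/esym/inf_attained.
  exists (p - k *: v + s *: u); first by exists s.
  by rewrite dE subrr expr0n /= mul0r add0r -mE.
move=> _ [_ [t _ <-] <-]; rewrite dE mE ler_wsqrtr // lerDr mulr_ge0 ?sqr_ge0 //.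
exact: ltW.
Qed.

(** Completing the square moves the parameter to the vertex, which makes the two
    direction vectors orthogonal. *)
Lemma quadratic_curve_parabolic (R : realType) (phi : R -> 'rV[R]_2)
    (gamma : set 'rV[R]_2) (p u v : 'rV[R]_2) :
  arc_on phi gamma -> u != 0 ->
  (forall z, gamma z -> exists t, z = p + t *: u + t ^+ 2 *: v) ->
  parabolic_segment gamma.
Proof.
move=> arc u0 H.
have [det|det] := eqVneq (u 0 0 * v 0 1) (u 0 1 * v 0 0).
  right; apply: (collinear_arc_segment arc).
  pose n : 'cV[R]_2 := \col_i (if i == 0 then u 0 1 else - u 0 0).
  exists n, (p *m n); split.
    apply/eqP => /colP E; move: (E 0) (E 1); rewrite !mxE /= => e1 /eqP.
    rewrite oppr_eq0 => /eqP e0; case/eqP: u0.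
    by apply: row2P; rewrite mxE.
  move=> z /H [t ->]; apply/matrixP => i j.
  rewrite (ord1 i) (ord1 j) !mulmx2E !mxE /=; apply: subr0_eq.
  transitivity (- t ^+ 2 * (u 0 0 * v 0 1 - u 0 1 * v 0 0)); first by ring.
  by rewrite det subrr mulr0.
have v0 : v != 0.
  by apply: contra det => /eqP ->; rewrite !mxE !mulr0.
have vv := dot_gt0 v0.
pose r := - dot u v / (2 * dot v v).
have rE : 2 * r * dot v v = - dot u v.
  by rewrite /r mulrAC mulrCA mulfV ?mulr1 // gt_eqF // mulr_gt0.
pose u' := u + (2 * r) *: v.
have u'0 : u' != 0.
  apply: contra det => /eqP/rowP E; move: (E 0) (E 1); rewrite !mxE => e0 e1.
  have -> : u 0 0 = - (2 * r * v 0 0) by lra.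
  have -> : u 0 1 = - (2 * r * v 0 1) by lra.
  by apply/eqP; ring.
have u'v : dot u' v = 0.
  transitivity (dot u v + 2 * r * dot v v); first by rewrite /dot !mxE; ring.
  by rewrite rE subrr.
have [P parP PP] := parabola_of_orthogonal (p + r *: u + r ^+ 2 *: v) u'0 v0 u'v.
left; split.
  by exists (phi 0), (phi 1), phi; split=> //; exact: arc_on_param.
exists P; split=> // z /H [t ->]; have := PP (t - r); congr P.
by apply/rowP => i; rewrite !mxE; ring.
Qed.

(** * Affine vector fields *)

Lemma entry_le_norm (R : realType) m n (A : 'M[R]_(m, n)) i j : `|A i j| <= `|A|.
Proof.
rewrite [leRHS]/Num.norm /= mx_normrE.
exact: (le_bigmax _ (fun ij => `|A ij.1 ij.2|) (i, j)).
Qed.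

Lemma norm_le_entries (R : realType) m n (A : 'M[R]_(m, n)) c :
  0 <= c -> (forall i j, `|A i j| <= c) -> `|A| <= c.
Proof.
move=> c0 H; rewrite [leLHS]/Num.norm /= mx_normrE.
by apply: bigmax_le => // -[i j] _; exact: H.
Qed.

Lemma mulmx2_norm (R : realType) m n (A : 'M[R]_(m, 2)) (B : 'M[R]_(2, n)) :
  `|A *m B| <= 2 * `|A| * `|B|.
Proof.
apply: norm_le_entries => [|i j]; first by rewrite !mulr_ge0.
rewrite mulmx2E (le_trans (ler_normD _ _)) // !normrM.
have -> : 2 * `|A| * `|B| = `|A| * `|B| + `|A| * `|B| by ring.
by apply: lerD; apply: ler_pM => //; exact: entry_le_norm.
Qed.

(** The pair [(M, b)] stands for the vector field [z |-> z M + b], equivalently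
    for the displacement of the affine map [z |-> z + (z M + b)]. *)
Notation affine_field R := ('M[R]_2 * 'rV[R]_2)%type.

Definition fev (R : realType) (F : affine_field R) (z : 'rV[R]_2) : 'rV[R]_2 :=
  z *m F.1 + F.2.

Definition push (R : realType) (F : affine_field R) (z : 'rV[R]_2) : 'rV[R]_2 :=
  z + fev F z.

Lemma fevB (R : realType) (F G : affine_field R) z : fev (F - G) z = fev F z - fev G z.
Proof. by rewrite /fev /= mulmxBr opprD addrACA. Qed.

Lemma fevZ (R : realType) c (F : affine_field R) z : fev (c *: F) z = c *: fev F z.
Proof. by rewrite /fev /= -scalemxAr scalerDr. Qed.

Lemma fev_sub (R : realType) (F : affine_field R) x y : fev F x - fev F y = (x - y) *m F.1.
Proof. by rewrite /fev mulmxBl opprD addrACA subrr addr0. Qed.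

Lemma pushE (R : realType) (F : affine_field R) z : push F z = z *m (1%:M + F.1) + F.2.
Proof. by rewrite /push /fev mulmxDr mulmx1 addrA. Qed.

Lemma field_norm_le (R : realType) (F : affine_field R) c :
  (`|F| <= c) = (`|F.1| <= c) && (`|F.2| <= c).
Proof. by rewrite prod_normE ge_max. Qed.

Lemma fst_norm_le (R : realType) (F : affine_field R) : `|F.1| <= `|F|.
Proof. by rewrite prod_normE le_max lexx. Qed.

Lemma fev_norm (R : realType) (F : affine_field R) z : `|fev F z| <= (2 * `|z| + 1) * `|F|.
Proof.
have := lexx `|F|; rewrite {1}field_norm_le => /andP[F1 F2].
rewrite mulrDl mul1r; apply: (le_trans (ler_normD _ _)); apply: lerD => //.
by apply: (le_trans (mulmx2_norm _ _)); apply: ler_wpM2l => //; rewrite mulr_ge0.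
Qed.

Lemma continuous_fev (R : realType) (F : affine_field R) : continuous (fev F).
Proof.
move=> x; apply/(@cvgrPdist_lt R 'rV[R]_2 _ (nbhs x) _ (fev F)) => e e0.
have K0 : 0 < 2 * `|F.1| + 1 by rewrite ltr_wpDl // mulr_ge0.
have e'0 : 0 < e / (2 * `|F.1| + 1) by rewrite divr_gt0.
have /cvgrPdist_lt /(_ _ e'0) nh : y @[y --> x] --> x by exact: cvg_id.
near=> y; rewrite fev_sub.
apply: (@le_lt_trans _ _ (`|x - y| * (2 * `|F.1| + 1))).
  apply: (le_trans (mulmx2_norm _ _)); rewrite mulrDr mulr1 mulrCA !mulrA.
  by rewrite lerDl.
rewrite -ltr_pdivlMr //; near: y; exact: nh.
Unshelve. all: by end_near. Qed.

Lemma continuous_push (R : realType) (F : affine_field R) : continuous (push F).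
Proof. move=> x; apply: (@cvgD R 'rV[R]_2 _ (nbhs x) _ id (fev F)).
  by [].
exact: continuous_fev.
Qed.

Lemma push_unit (R : realType) (F : affine_field R) : `|F| < 4^-1 -> 1%:M + F.1 \in unitmx.
Proof.
move=> F4; rewrite unitmxE unitfE; apply/negP => /det0P[v v0].
rewrite mulmxDr mulmx1 => /eqP; rewrite addr_eq0 => /eqP vE.
have v0' : 0 < `|v| by rewrite normr_gt0.
have := mulmx2_norm v F.1; rewrite -normrN -vE.
have := fst_norm_le F; nra.
Qed.

(** Bolzano-Weierstrass for normalised fields; a convergent subsequence is
    expressed by approximation along arbitrarily large indices. *)
Lemma field_cluster (R : realType) (F : nat -> affine_field R) :
  (forall n, `|F n| = 1) ->
  exists2 V : affine_field R, `|V| = 1 &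
    forall eta, 0 < eta -> forall N, exists2 n, (N <= n)%N & `|F n - V| < eta.
Proof.
move=> F1; pose e (G : affine_field R) : 'rV[R]_(2 * 2 + 2) := row_mx (mxvec G.1) G.2.
pose K := [set v : 'rV[R]_(2 * 2 + 2) | forall i, `[(-1 : R), 1]%classic (v 0 i)].
have cK : compact K.
  by apply: (@rV_compact _ _ (fun=> `[(-1 : R), 1]%classic)) => _; exact: segment_compact.
have KF n : K (e (F n)).
  move=> i /=; rewrite in_itv /= -ler_norml.
  have := lexx `|F n|; rewrite {1}field_norm_le F1 => /andP[H1 H2].
  rewrite /e mxE; case: (fintype.split i) => j; first last.
    exact: (le_trans (entry_le_norm _ _ _) H2).
  case/mxvec_indexP: j => i' j'; rewrite mxvecE.
  exact: (le_trans (entry_le_norm _ _ _) H1).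
have [|v [_ vc]] := cK (e (F n) @[n --> \oo]) _; first by exists 0%N => // n _; exact: KF.
pose V : affine_field R := (vec_mx (lsubmx v), rsubmx v).
have VF n : `|F n - V| <= `|e (F n) - v|.
  rewrite field_norm_le; apply/andP; split; apply: norm_le_entries => // i j.
  - have -> : (F n - V).1 i j = (e (F n) - v) 0 (lshift 2 (mxvec_index i j)).
      by rewrite /= [RHS]mxE /e row_mxEl mxvecE !mxE.
    exact: entry_le_norm.
  - have -> : (F n - V).2 i j = (e (F n) - v) 0 (rshift (2 * 2) j).
      by rewrite (ord1 i) [RHS]mxE /e row_mxEr !mxE.
    exact: entry_le_norm.
have VP eta : 0 < eta -> forall N, exists2 n, (N <= n)%N & `|F n - V| < eta.
  move=> eta0 N.
  have := vc [set e (F n) | n in [set n | (N <= n)%N]] (ball v eta) _ (nbhsx_ballx _ _ eta0).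
  case; first by exists N => // n /= Nn; exists n.
  move=> _ [[n Nn <-]]; rewrite -ball_normE /= distrC => H.
  by exists n => //; exact: le_lt_trans (VF n) H.
exists V => //; apply/eqP; rewrite -subr_eq0 -normr_le0; apply/ler_addgt0Pr => eta eta0.
have [n _ H] := VP _ eta0 0%N.
rewrite add0r -(F1 n); apply: (le_trans _ (ltW H)); rewrite distrC.
exact: ler_dist_dist.
Qed.

Lemma zero_field_collinear (R : realType) (F : affine_field R) (X : set 'rV[R]_2) :
  F != 0 -> X !=set0 -> (forall z, X z -> fev F z = 0) -> collinear X.
Proof.
move=> F0 [z0 Xz0] H.
have M0 : F.1 != 0.
  apply: contra F0 => /eqP M0; have := H _ Xz0.
  by rewrite /fev M0 mulmx0 add0r => b0; case: (F) M0 b0 => M b /= -> ->.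
have [j j0] : exists j, col j F.1 != 0.
  apply/existsP; apply: contraR M0 => /existsPn H'; apply/eqP/matrixP => i j.
  by have /eqP/colP/(_ i) := negbNE (H' j); rewrite !mxE.
exists (col j F.1), (- col j F.2); split=> // z Xz.
have /rowP/(_ j) := H z Xz; rewrite mxE mulmx2E [RHS]mxE => E.
apply/matrixP => i k; rewrite (ord1 i) mulmx2E !mxE; apply/eqP.
by rewrite -addr_eq0 E.
Qed.

(** * Affine maps that shift an arc along itself *)

Lemma arc_bounded (R : realType) (phi : R -> 'rV[R]_2) (gamma : set 'rV[R]_2) :
  arc_on phi gamma -> exists2 B, 0 < B & forall z, gamma z -> `|z| <= B.
Proof.
case=> cphi _ <-.
have : bounded_set (phi @` `[0, 1]).
  apply: compact_bounded; apply: continuous_compact; last exact: segment_compact.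
  exact: continuous_subspaceT.
case=> M [_ HM]; exists (`|M| + 1); first by rewrite ltr_wpDl.
by move=> z gz; apply: HM gz; rewrite (le_lt_trans (ler_norm M)) // ltrDl.
Qed.

(** A small affine displacement moves points of the arc by small amounts, hence
    their parameters by small amounts as well. *)
Lemma push_param_near (R : realType) (phi : R -> 'rV[R]_2) (gamma : set 'rV[R]_2) :
  arc_on phi gamma -> forall eta, 0 < eta -> exists2 eps, 0 < eps &
    forall F : affine_field R, `|F| < eps -> forall s t, 0 <= s <= 1 -> 0 <= t <= 1 ->
      phi t = push F (phi s) -> `|t - s| < eta.
Proof.
move=> arc eta eta0.
have [rho rho0 H] := arc_inv_unif arc eta0.
have [B B0 HB] := arc_bounded arc.
have K0 : 0 < 2 * B + 1 by rewrite addr_gt0 // mulr_gt0.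
exists (rho / (2 * B + 1)); first by rewrite divr_gt0.
move=> F; rewrite ltr_pdivlMr // => Frho s t s01 t01 E; apply: H => //.
rewrite E /push addrAC subrr add0r; apply: le_lt_trans Frho.
apply: (le_trans (fev_norm _ _)); rewrite mulrC ler_wpM2l // lerD2r ler_pM2l //.
exact: HB (arc_mem arc s01).
Qed.

Definition shifts (R : realType) (phi : R -> 'rV[R]_2) (gamma : set 'rV[R]_2)
    (F : affine_field R) : Prop :=
  is_subarc gamma (push F (phi 0)) (phi 1) ((push F @` gamma) `&` gamma).

(** The points that [f] keeps on the arc form the preimage of [gamma (f a0, a1)],
    a subarc from [a0] to the preimage of [a1], which is close to [a1]. *)
Lemma shifts_initial (R : realType) (phi : R -> 'rV[R]_2) (gamma : set 'rV[R]_2) :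
  arc_on phi gamma -> forall eta, 0 < eta -> exists2 eps, 0 < eps &
    forall F : affine_field R, `|F| < eps -> shifts phi gamma F ->
      1%:M + F.1 \in unitmx /\
      exists tau, [/\ 0 <= tau <= 1, 1 - tau < eta, push F (phi tau) = phi 1 &
        forall u, 0 <= u <= tau -> gamma (push F (phi u))].
Proof.
move=> arc eta eta0; have [eps eps0 near] := push_param_near arc eta0.
exists (Num.min eps 4^-1); first by rewrite lt_min eps0 invr_gt0 ltr0n.
move=> F; rewrite lt_min => /andP[Feps F4] sh.
have Fu := push_unit F4; split=> //.
have [phi' [s' [t' [arc0 [/andP[s'0 st'] t'1] s'E t'E imE]]]] := sh.
have [phi'' arc'' pE] := arc_param_on arc0.
have s'01 : 0 <= s' <= 1 by rewrite s'0 (le_trans st').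
have t'01 : 0 <= t' <= 1 by rewrite t'1 (le_trans s'0).
have gf0 : gamma (push F (phi 0)) by rewrite -s'E -pE //; exact: arc_mem arc'' _.
have [s0 s01 s0E] := arc_memP arc gf0.
have pre v : s0 <= v <= 1 -> exists2 w, gamma w & push F w = phi v.
  move=> vs.
  have [|||||u ust uE] := @arc_IVT R phi gamma phi'' s' t' s0 1 v arc _ st' _ s01 (itv01_1 R).
  - by have [] := arc''.
  - move=> u /andP[su ut]; apply: (arc_mem arc'').
    by rewrite (le_trans s'0 su) (le_trans ut t'1).
  - by rewrite s0E pE.
  - by rewrite pE.
  - by rewrite vs.
  have : (phi' @` `[s', t']) (phi v).
    exists u; first by rewrite /= in_itv.
    rewrite -uE pE //; case/andP: ust => su ut.
    by rewrite (le_trans s'0 su) (le_trans ut t'1).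
  by rewrite -imE => -[[w gw wE] _]; exists w.
pose A := invmx (1%:M + F.1); pose g : affine_field R := (A, - F.2 *m A).
have gf z : fev g (push F z) = z.
  by rewrite /fev /= pushE -mulmxDl addrK -mulmxA mulmxV // mulmx1.
have fg z : push F (fev g z) = z.
  by rewrite pushE /fev /= -mulmxDl -mulmxA mulVmx // mulmx1 subrK.
have ch : continuous (fun v => fev g (phi v)).
  move=> v; have [cphi _ _] := arc.
  by apply: continuous_comp; [exact: cphi|exact: continuous_fev].
have gh v : s0 <= v <= 1 -> gamma (fev g (phi v)).
  by move=> /pre[w gw <-]; rewrite gf.
have [s00 s0le] := andP s01.
have [|tau t01 tauE] := arc_memP arc (gh 1 _); first by rewrite s0le lexx.
have ftau : push F (phi tau) = phi 1 by rewrite tauE fg.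
exists tau; split=> //.
  by apply: (le_lt_trans (ler_norm _)); exact: (near F Feps tau 1 t01 (itv01_1 R)).
move=> u ut.
have [|||v vs <-] := @arc_IVT R phi gamma _ s0 1 0 tau u arc ch s0le gh (itv01_0 R) t01.
- by rewrite s0E gf.
- by [].
- by rewrite ut.
rewrite fg; apply: (arc_mem arc); case/andP: vs => sv ->.
by rewrite (le_trans s00 sv).
Qed.

Lemma two_points_line (R : realType) (p q : 'rV[R]_2) (n n' : 'cV[R]_2) (d d' : 'M[R]_1) :
  p != q -> n != 0 -> p *m n = d -> q *m n = d -> p *m n' = d' -> q *m n' = d' ->
  forall z, z *m n = d -> z *m n' = d'.
Proof.
move=> pq n0 pn qn pn' qn' z zn.
have e1 : (z - p) *m n = 0 by rewrite mulmxBl zn pn subrr.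
have e2 : (q - p) *m n = 0 by rewrite mulmxBl qn pn subrr.
have e3 : (q - p) *m n' = 0 by rewrite mulmxBl qn' pn' subrr.
move: e1 e2 e3 => /matrixP/(_ 0 0) + /matrixP/(_ 0 0) + /matrixP/(_ 0 0).
rewrite !mulmx2E [RHS]mxE => e1; rewrite [RHS]mxE => e2; rewrite [RHS]mxE => e3.
have det := orth_proportional e1 e2 (cV2_neq0 n0).
suff : (z - p) *m n' = 0 by rewrite mulmxBl pn' => /eqP; rewrite subr_eq0 => /eqP.
apply/matrixP => i j; rewrite (ord1 i) (ord1 j) mulmx2E [RHS]mxE.
have [c0|c0] : (q - p) 0 0 != 0 \/ (q - p) 0 1 != 0.
- case: (eqVneq ((q - p) 0 0) 0) => [h0|]; last by left.
  right; apply: contra pq => /eqP h1; rewrite eq_sym -subr_eq0; apply/eqP.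
  by apply: row2P; rewrite ?h0 ?h1 mxE.
- apply: (mulIf c0); rewrite mul0r.
  transitivity ((z - p) 0 0 * ((q - p) 0 0 * n' 0 0 + (q - p) 0 1 * n' 1 0)
    - ((z - p) 0 0 * (q - p) 0 1 - (z - p) 0 1 * (q - p) 0 0) * n' 1 0); first by ring.
  by rewrite e3 det; ring.
- apply: (mulIf c0); rewrite mul0r.
  transitivity ((z - p) 0 1 * ((q - p) 0 0 * n' 0 0 + (q - p) 0 1 * n' 1 0)
    + ((z - p) 0 0 * (q - p) 0 1 - (z - p) 0 1 * (q - p) 0 0) * n' 0 0); first by ring.
  by rewrite e3 det; ring.
Qed.

(** The form in which hypothesis (ii) is used; fixed points of the maps are zeros
    of their displacements. *)
Definition small_shifts (R : realType) (phi : R -> 'rV[R]_2) (gamma : set 'rV[R]_2) :=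
  forall eps, 0 < eps -> exists F : affine_field R,
    [/\ `|F| < eps, shifts phi gamma F & forall z, gamma z -> fev F z <> 0].

(** In the parameter a fixed-point-free shift moves every point forward by at
    least a constant [mu], because its displacement is continuous, never zero, and
    positive at the parameter [tau] sent to the end of the arc. *)
Lemma shift_forward (R : realType) (phi : R -> 'rV[R]_2) (gamma : set 'rV[R]_2)
    (F : affine_field R) (tau : R) :
  arc_on phi gamma -> (forall z, gamma z -> fev F z <> 0) ->
  0 <= tau <= 1 -> push F (phi tau) = phi 1 ->
  (forall u, 0 <= u <= tau -> gamma (push F (phi u))) ->
  exists theta mu : _, [/\ continuous (theta : R -> R), 0 < mu, theta tau = 1 &
    forall u, 0 <= u <= tau ->
      [/\ 0 <= theta u <= 1, phi (theta u) = push F (phi u) & u + mu <= theta u]].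
Proof.
move=> arc nofix /andP[tau0 tau1] ftau gf.
have [||theta ctheta tP] := @arc_lift R phi gamma (fun u => push F (phi (clamp 0 tau u))) arc.
- have [cphi _ _] := arc.
  move=> x; apply: (@continuous_comp _ _ _ (fun u => phi (clamp 0 tau u)) (push F)).
    by apply: continuous_comp; [exact: continuous_clamp|exact: cphi].
  exact: continuous_push.
- by move=> u; apply: gf; exact: clamp_itv.
have tE u : 0 <= u <= tau -> 0 <= theta u <= 1 /\ phi (theta u) = push F (phi u).
  by move=> ut; have [? E] := tP u; rewrite E clampE.
have tau_tau : 0 <= tau <= tau by rewrite tau0 lexx.
have t1 : theta tau = 1.
  have [t01 E] := tE _ tau_tau.
  by apply: (arc_inj arc t01 (itv01_1 R)); rewrite E.
have nf u : 0 <= u <= tau -> theta u != u.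
  move=> ut; apply/eqP => E; have [t01 pE] := tE _ ut; rewrite E in t01 pE.
  apply: (nofix (phi u)); first by exact: (arc_mem arc t01).
  by apply: (addrI (phi u)); rewrite addr0 [RHS]pE.
have cd : continuous (fun u => theta u - u).
  by move=> x; apply: cvgB; [exact: ctheta|exact: cvg_id].
have pos u : 0 <= u <= tau -> 0 < theta u - u.
  move=> /andP[u0 ut]; rewrite ltNge; apply/negP => H.
  have [|w /andP[uw wt] wE] := @IVT_between R _ u tau 0 ut cd.
    by rewrite H t1 subr_ge0 tau1.
  move/eqP: wE; rewrite subr_eq0; apply/negP/nf.
  by rewrite wt (le_trans u0).
have I0 : `[0, tau]%classic !=set0 by exists tau; rewrite /= in_itv.
have [c] := compact_EVT_min I0 (@segment_compact R 0 tau) (continuous_subspaceT cd).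
rewrite inE /= in_itv /= => c0 cmin.
exists theta, (theta c - c); split=> //; first exact: pos.
move=> u ut; have [? ?] := tE _ ut; split=> //.
rewrite -lerBrDl; apply: cmin.
by rewrite inE /= in_itv.
Qed.

(** A shift close to the identity sends the line of a straight subarc to itself,
    since the subarc overlaps its image. Along a small shift [theta] of the
    parameter, membership in that line thus spreads from the subarc forward, from
    [u] to [theta u], and backward, from [theta u] to [u]. *)
Lemma straight_subarc_collinear (R : realType) (phi : R -> 'rV[R]_2)
    (gamma : set 'rV[R]_2) (b c : R) :
  arc_on phi gamma -> small_shifts phi gamma -> 0 <= b -> b < c -> c <= 1 ->
  collinear (phi @` `[b, c]) -> collinear gamma.
Proof.
move=> arc sh b0 bc0 c01 [n [d [n0 nd0]]].
(* a shift by less than a quarter of the subarc keeps the points with parameters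
   [b] and [b + e] on it *)
pose e := (c - b) / 4.
have e0 : 0 < e by rewrite divr_gt0 // subr_gt0.
have eE : c = b + 4 * e by rewrite /e mulrC divfK ?subrKC // pnatr_eq0.
have [eps1 eps10 near] := push_param_near arc e0.
have [eps2 eps20 ini] := shifts_initial arc e0.
have [|F [Feps shF nofix]] := sh (Num.min eps1 eps2); first by rewrite lt_min eps10.
move: Feps; rewrite lt_min => /andP[F1 F2].
have [Fu [tau [tau01 taue ftau gf]]] := ini _ F2 shF.
have [theta [mu [ctheta mu0 t1 tP]]] := shift_forward arc nofix tau01 ftau gf.
pose T u := phi u *m n = d.
have T0 u : b <= u <= c -> T u by move=> ubc; apply: nd0; exists u; rewrite //= in_itv.
have tau_le u : 0 <= u -> u <= b + 2 * e -> 0 <= u <= tau.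
  by move=> -> ule /=; lra.
have nearT u : b <= u -> u <= b + 2 * e -> T (theta u).
  move=> bu ule; have ut := tau_le u (le_trans b0 bu) ule.
  have [t01 tE tmu] := tP _ ut; apply: T0.
  have u01 : 0 <= u <= 1 by lra.
  have := near _ F1 _ _ u01 t01 tE.
  by rewrite ltr_norml => /andP[H1 H2]; apply/andP; split; lra.
have bu : b <= b + e by lra.
have ind : phi b != phi (b + e).
  apply/eqP => E; suff : b = b + e by lra.
  by apply: (arc_inj arc) E; apply/andP; split; lra.
pose n' := (1%:M + F.1) *m n; pose d' := d - F.2 *m n.
have pushT z : push F z *m n = d <-> z *m n' = d'.
  rewrite pushE mulmxDl -mulmxA -/n' /d'; split=> [<-|->]; first by rewrite addrK.
  by rewrite subrK.
have n'0 : n' != 0.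
  by apply: contra n0 => /eqP E; rewrite -[n](mulKmx Fu) -/n' E mulmx0.
have bT : T b by apply: T0; rewrite lexx ltW.
have eT : T (b + e) by apply: T0; apply/andP; split; lra.
have bt : 0 <= b <= tau by apply: tau_le => //; lra.
have bet : 0 <= b + e <= tau by apply: tau_le; lra.
have bT' : phi b *m n' = d'.
  by apply/pushT; have [_ <- _] := tP _ bt; apply: nearT; lra.
have eT' : phi (b + e) *m n' = d'.
  by apply/pushT; have [_ <- _] := tP _ bet; apply: nearT; lra.
have TT u : 0 <= u <= tau -> T (theta u) <-> T u.
  move=> ut; have [_ tE _] := tP _ ut; rewrite /T tE; split.
    move/pushT; exact: (two_points_line ind n'0 bT' eT' bT eT).
  by move=> H; apply/pushT; exact: (two_points_line ind n0 bT eT bT' eT').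
have [/andP[tau0 tau1]] := tau01.
have fwd m : forall v, b <= v <= 1 -> v <= c + m%:R * mu -> T v.
  elim: m => [|m IH] v /andP[bv v1] vle.
    by apply: T0; rewrite bv /=; move: vle; rewrite mul0r addr0.
  have [vc|cv] := leP v c; first by apply: T0; rewrite bv.
  have [||u /andP[bu' ut] uE] := @IVT_between R theta b tau v _ ctheta; first lra.
    have tb : theta b <= c.
      have [t01 tE _] := tP _ bt.
      have b01 : 0 <= b <= 1 by lra.
      have := near _ F1 _ _ b01 t01 tE.
      by rewrite ltr_norml => /andP[H1 H2]; lra.
    by rewrite t1 v1 (le_trans tb (ltW cv)).
  have u0t : 0 <= u <= tau by rewrite ut (le_trans b0).
  have [_ _ umu] := tP _ u0t.
  rewrite -uE; apply/(TT _ u0t); apply: IH; first by lra.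
  by move: vle; rewrite -natr1 mulrDl mul1r; lra.
have bwd m : forall u, 0 <= u <= 1 -> b - m%:R * mu <= u -> T u.
  elim: m => [|m IH] u /andP[u0 u1] ule.
    have [k kP] : exists k : nat, (1 - c) / mu < k%:R.
      exists (Num.bound ((1 - c) / mu)); apply: archi_boundP.
      by rewrite divr_ge0 ?subr_ge0 ?c01 ?(ltW mu0).
    apply: (fwd k); first by rewrite u1 andbT; move: ule; rewrite mul0r subr0.
    by move: kP; rewrite ltr_pdivrMr //; lra.
  have [bu'|ub] := leP b u.
    apply: IH; first by rewrite u0.
    by rewrite lerBlDr (le_trans bu') // lerDl mulr_ge0 // ltW.
  have ut : 0 <= u <= tau by apply: tau_le => //; lra.
  have [t01 _ umu] := tP _ ut.
  apply/(TT _ ut); apply: IH => //.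
  by move: ule; rewrite -natr1 mulrDl mul1r; lra.
exists n, d; split=> // z gz; have [u u01 <-] := arc_memP arc gz.
have [k kP] : exists k : nat, b / mu < k%:R.
  by exists (Num.bound (b / mu)); apply: archi_boundP; rewrite divr_ge0 // ltW.
apply: (bwd k) => //; move: kP; rewrite ltr_pdivrMr // => kP.
by have [? ?] := andP u01; lra.
Qed.

(** * Renormalised displacements *)

(** The image of the arc lies on a line. Either it is a point, so that the arc lies
    in a fibre of the map, or it covers a straight subarc. *)
Lemma singular_self_map_collinear (R : realType) (phi : R -> 'rV[R]_2)
    (gamma : set 'rV[R]_2) (A : 'M[R]_2) (b : 'rV[R]_2) :
  arc_on phi gamma -> small_shifts phi gamma -> A != 0 -> A \notin unitmx ->
  (forall z, gamma z -> gamma (z *m A + b)) -> collinear gamma.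
Proof.
move=> arc sh A0 Anu Sg.
have [cphi _ _] := arc.
have [n n0 An] : exists2 n : 'cV[R]_2, n != 0 & A *m n = 0.
  move: Anu; rewrite unitmxE -det_tr unitfE negbK => /det0P[v v0 vA].
  exists v^T; first by rewrite -trmx0 (inj_eq trmx_inj).
  by apply: trmx_inj; rewrite trmx_mul trmxK vA trmx0.
have Sn z : (z *m A + b) *m n = b *m n by rewrite mulmxDl -mulmxA An mulmx0 add0r.
pose h t := phi t *m A + b.
have ch : continuous h.
  move=> t; apply: (@continuous_comp _ _ _ phi (fev (A, b))); first exact: cphi.
  exact: continuous_fev.
have [[p [p' [p01 p'01 pp' hpp']]]|nex] :=
    pselect (exists p p', [/\ 0 <= p <= 1, 0 <= p' <= 1, p <= p' & h p != h p']).
  have ghp := Sg _ (arc_mem arc p01); have ghp' := Sg _ (arc_mem arc p'01).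
  have [s s01 sE] := arc_memP arc ghp; have [t t01 tE] := arc_memP arc ghp'.
  have st : s != t by apply: contra hpp' => /eqP st; rewrite /h -sE -tE st.
  have H v : (s <= v <= t) || (t <= v <= s) -> phi v *m n = b *m n.
    move=> sv; have [|u _ <-] := @arc_IVT R phi gamma h p p' s t v arc ch pp' _ s01 t01 sE tE sv.
      move=> u /andP[pu up]; apply: Sg; apply: (arc_mem arc).
      by case/andP: p01 => ? ?; case/andP: p'01 => ? ?; apply/andP; split; lra.
    exact: Sn.
  have [s0 s1] := andP s01; have [t0 t1] := andP t01.
  case: (ltgtP s t) st => // st _.
    apply: (straight_subarc_collinear arc sh s0 st t1); exists n, (b *m n); split=> //.
    by move=> _ [v /= + <-]; rewrite in_itv /= => vst; apply: H; rewrite vst.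
  apply: (straight_subarc_collinear arc sh t0 st s1); exists n, (b *m n); split=> //.
  by move=> _ [v /= + <-]; rewrite in_itv /= => vst; apply: H; rewrite vst orbT.
(* the map is constant on the arc, which lies in one of its fibres *)
apply: (@zero_field_collinear R (A, - phi 0 *m A)).
- by apply: contra A0 => /eqP [-> _].
- by exists (phi 0); apply: (arc_mem arc (itv01_0 R)).
move=> z gz; have [t t01 <-] := arc_memP arc gz.
rewrite /fev /= mulNmx; apply/eqP; rewrite subr_eq0 -(inj_eq (addIr b)).
apply: contrapT => /negP H; apply: nex; exists 0, t; split=> //; first exact: itv01_0.
  by case/andP: t01.
by rewrite eq_sym.
Qed.

(** A nonzero affine field vanishes on a line at most, so by continuity it is
    bounded below on some subarc, which can be kept away from both ends. *)
Lemma field_nonzero_subarc (R : realType) (phi : R -> 'rV[R]_2) (gamma : set 'rV[R]_2)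
    (V : affine_field R) :
  arc_on phi gamma -> ~ collinear gamma -> V != 0 ->
  exists s1 s2 c, [/\ 0 < s1, s1 < s2, s2 < 1, 0 < c &
    forall s, s1 <= s <= s2 -> c <= `|fev V (phi s)|].
Proof.
move=> arc ncol V0; have [cphi _ _] := arc.
have [p gp pV] : exists2 p, gamma p & fev V p != 0.
  apply: contrapT => nex; apply: ncol; apply: (zero_field_collinear V0).
    by exists (phi 0); apply: (arc_mem arc (itv01_0 R)).
  by move=> z gz; apply: contrapT => /eqP zV; apply: nex; exists z.
have [s0 /andP[s00 s01] s0E] := arc_memP arc gp.
pose c := `|fev V p| / 2.
have c0 : 0 < c by rewrite divr_gt0 // normr_gt0.
have cE : `|fev V p| = c + c by rewrite /c -splitr.
have cf : continuous (fun t => fev V (phi t)).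
  by move=> t; apply: continuous_comp; [exact: cphi|exact: continuous_fev].
have /cvgrPdist_lt /(_ _ c0) /nbhs_ballP[r /= r0 rP] := cf s0.
pose e := Num.min r 1 / 2.
have e0 : 0 < e by rewrite divr_gt0 // lt_min r0 ltr01.
have er : e < r.
  rewrite /e ltr_pdivrMr //; apply: (@le_lt_trans _ _ r); first by rewrite ge_min lexx.
  by rewrite ltr_pMr // ltr1n.
have e1 : e <= 1.
  by rewrite /e ler_pdivrMr // ge_min mul1r (ler1n R 2) orbT.
(* moving [s0] slightly towards [1 / 2] leaves the ends of the unit interval *)
exists ((1 - e) * s0 + e / 4), ((1 - e) * s0 + e / 2), c.
have es : 0 <= e * s0 <= e by rewrite mulr_ge0 ?(ltW e0) //= ler_piMr // ltW.
have es' : (1 - e) * s0 <= 1 - e by rewrite ler_piMr // subr_ge0.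
have es'' : 0 <= (1 - e) * s0 by rewrite mulr_ge0 // subr_ge0.
split=> //; [by lra|by lra|by lra|].
move=> s /andP[s1 s2]; have /rP : ball s0 r s.
  rewrite -ball_normE /= ltr_norml; move: s1 s2; rewrite mulrBl mul1r => s1 s2.
  by case/andP: es => ? ?; apply/andP; split; lra.
rewrite /= s0E => H; have := lerB_dist (fev V p) (fev V (phi s)).
by rewrite cE; lra.
Qed.

(** Hypothesis (i) with the Lipschitz constant replaced by the sup norm of the
    linear part, and non-constancy by its non-vanishing. *)
Definition small_self_maps (R : realType) (phi : R -> 'rV[R]_2) (gamma : set 'rV[R]_2) :=
  forall eps s t, 0 < eps -> 0 <= s -> s < t -> t <= 1 ->
    exists (A : 'M[R]_2) (b : 'rV[R]_2), [/\ A != 0, `|A| <= eps &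
      forall z, gamma z -> (phi @` `[s, t]) (z *m A + b)].

Lemma det2 (R : comRingType) (M : 'M[R]_2) : \det M = M 0 0 * M 1 1 - M 0 1 * M 1 0.
Proof.
rewrite (expand_det_row _ 0) !big_ord_recl big_ord0 addr0 /cofactor.
rewrite !det_mx11 !mxE /= expr0 mul1r expr1 mulN1r mulrN.
by congr (_ * M _ _ - M _ _ * M _ _); apply: val_inj.
Qed.

Lemma mxtrace2 (R : comRingType) (M : 'M[R]_2) : \tr M = M 0 0 + M 1 1.
Proof.
by rewrite /mxtrace !big_ord_recl big_ord0 addr0; congr (_ + M _ _); apply: val_inj.
Qed.

Lemma mxtrace2_norm (R : realType) (M : 'M[R]_2) : `|\tr M| <= 2 * `|M|.
Proof.
rewrite mxtrace2 (le_trans (ler_normD _ _)) //.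
have := entry_le_norm M 0 0; have := entry_le_norm M 1 1; lra.
Qed.

Lemma det2_norm (R : realType) (M : 'M[R]_2) : `|\det M| <= 2 * `|M| ^+ 2.
Proof.
rewrite det2 (le_trans (ler_normB _ _)) // !normrM mulr_natl mulr2n expr2.
by apply: lerD; apply: ler_pM => //; exact: entry_le_norm.
Qed.

(** By monotonicity the margin is the smaller of the distances from [theta eta]
    to [theta 0] and from [theta (1 - eta)] to [theta 1]. *)
Lemma injective_inner_margin (R : realType) (theta : R -> R) (eta : R) :
  continuous theta -> {in `[0, 1] &, injective theta} -> 0 < eta ->
  exists2 mu, 0 < mu & forall s v, eta <= s -> s <= 1 - eta -> `|v - theta s| < mu ->
    (theta 0 <= v <= theta 1) || (theta 1 <= v <= theta 0).
Proof.
move=> cth ith eta0.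
have [eta1|eta1] := ltP (1 - eta) eta.
  by exists 1 => // s v es se _; move: (lt_le_trans eta1 es); rewrite ltNge se.
have inc (f : R -> R) : {in `[0, 1] &, {homo f : x y / x < y}} ->
    exists2 mu, 0 < mu & forall s v, eta <= s -> s <= 1 - eta -> `|v - f s| < mu ->
      f 0 <= v <= f 1.
  move=> hf.
  have I x : 0 <= x -> x <= 1 -> x \in `[0, 1] by rewrite in_itv /= => -> ->.
  have hle x y : 0 <= x -> x <= y -> y <= 1 -> f x <= f y.
    move=> x0; rewrite le_eqVlt => /predU1P[->//|xy] y1.
    by apply/ltW/hf => //; apply: I; lra.
  exists (Num.min (f eta - f 0) (f 1 - f (1 - eta))).
    by rewrite lt_min !subr_gt0; apply/andP; split; apply: hf; try (apply: I); lra.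
  move=> s v es se; rewrite lt_min !ltr_norml => /andP[/andP[h1 h2] /andP[h3 h4]].
  have := hle eta s (ltW eta0) es; have := hle s (1 - eta) _ se _.
  by move=> H1 H2; apply/andP; split; [have := H2 _|have := H1 _ _]; lra.
have [/inc[mu mu0 H]|dec] := itv_continuous_inj_mono (continuous_subspaceT cth) ith.
  by exists mu => // s v es se /H -> //.
have [|mu mu0 H] := inc (fun x => - theta x).
  by move=> x y xI yI xy; rewrite ltrN2; exact: dec.
exists mu => // s v es se vs.
have vs' : `|- v - - theta s| < mu by rewrite -opprD normrN.
by have /andP[] := H s (- v) es se vs'; rewrite !lerN2 => -> ->; rewrite orbT.
Qed.

(** The displacement of [S^-1 f S], where [S z = z A + b] and [f] is [push F]. *)
Definition conj_field (R : realType) (A : 'M[R]_2) (b : 'rV[R]_2)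
    (F : affine_field R) : affine_field R :=
  (A *m F.1 *m invmx A, (b *m F.1 + F.2) *m invmx A).

Lemma conj_fieldE (R : realType) (A : 'M[R]_2) (b : 'rV[R]_2) (F : affine_field R) z :
  A \in unitmx -> fev (conj_field A b F) z *m A = fev F (z *m A + b).
Proof.
move=> Au; rewrite /fev /conj_field /= mulmxDl -!mulmxA mulVmx // !mulmx1.
by rewrite mulmxDl addrA mulmxA.
Qed.

Lemma push_conj_field (R : realType) (A : 'M[R]_2) (b : 'rV[R]_2) (F : affine_field R) z :
  A \in unitmx ->
  push (conj_field A b F) z *m A + b = push F (z *m A + b).
Proof. by move=> Au; rewrite /push mulmxDl conj_fieldE // addrAC. Qed.

Lemma trace_conj_field (R : realType) (A : 'M[R]_2) (b : 'rV[R]_2) (F : affine_field R) :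
  A \in unitmx -> \tr (conj_field A b F).1 = \tr F.1.
Proof. by move=> Au; rewrite /= mxtrace_mulC mulKmx. Qed.

Lemma det_conj_field (R : realType) (A : 'M[R]_2) (b : 'rV[R]_2) (F : affine_field R) :
  A \in unitmx -> \det (conj_field A b F).1 = \det F.1.
Proof.
move=> Au; rewrite /= !det_mulmx mulrAC -det_mulmx mulmxV // det1 mul1r //.
Qed.

Lemma conj_field_norm (R : realType) (A : 'M[R]_2) (b : 'rV[R]_2) (F : affine_field R) :
  `|conj_field A b F| <= (4 * `|A| * `|invmx A| + 2 * (2 * `|b| + 1) * `|invmx A|) * `|F|.
Proof.
have P : 0 <= 4 * `|A| * `|invmx A| * `|F| by rewrite !mulr_ge0.
have Q : 0 <= 2 * (2 * `|b| + 1) * `|invmx A| * `|F|.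
  by rewrite !mulr_ge0 // addr_ge0 // mulr_ge0.
rewrite mulrDl field_norm_le; apply/andP; split.
  rewrite /= -[leLHS]addr0; apply: lerD => //.
  apply: (le_trans (mulmx2_norm _ _)).
  have -> : 4 * `|A| * `|invmx A| * `|F| = 2 * (2 * `|A| * `|F|) * `|invmx A| by ring.
  apply: ler_wpM2r => //; apply: ler_wpM2l => //.
  apply: (le_trans (mulmx2_norm _ _)); apply: ler_wpM2l; last exact: fst_norm_le.
  by rewrite mulr_ge0.
rewrite /= -[leLHS]add0r; apply: lerD => //.
apply: (le_trans (mulmx2_norm _ _)).
have -> : 2 * (2 * `|b| + 1) * `|invmx A| * `|F| =
  2 * ((2 * `|b| + 1) * `|F|) * `|invmx A| by ring.
by apply: ler_wpM2r => //; apply: ler_wpM2l => //; exact: fev_norm.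
Qed.

(** Conjugating a shift [f] by a self-map [S] with linear part [A] keeps the
    trace and determinant of the linear part of the displacement, while the
    displacement itself grows by a factor of order [1 / |A|] if [S] maps the arc to
    where [f] moves points by a definite fraction of its size. *)
Lemma renormalised_shift (R : realType) (phi : R -> 'rV[R]_2) (gamma : set 'rV[R]_2) :
  arc_on phi gamma -> small_shifts phi gamma -> small_self_maps phi gamma ->
  ~ collinear gamma -> forall eta, 0 < eta -> exists U : affine_field R,
    [/\ 0 < `|U| < eta, `|\tr U.1| <= eta * `|U|, `|\det U.1| <= eta * `|U| ^+ 2 &
      forall s, eta <= s -> s <= 1 - eta -> gamma (push U (phi s))].
Proof.
move=> arc sh self ncol eta eta0; have [cphi _ _] := arc.
have /choice[F FP] : forall k : nat, exists F : affine_field R,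
    [/\ `|F| < k.+1%:R^-1, shifts phi gamma F & forall z, gamma z -> fev F z <> 0].
  by move=> k; apply: sh; rewrite invr_gt0 ltr0n.
have Fpos k : 0 < `|F k|.
  rewrite normr_gt0; apply/eqP => F0; have [_ _ nofix] := FP k.
  apply: (nofix (phi 0)); first exact: (arc_mem arc (itv01_0 R)).
  by rewrite F0 /fev /= mulmx0 addr0.
have [|V V1 VP] := @field_cluster R (fun k => `|F k|^-1 *: F k).
  by move=> k; rewrite normrZ normfV normr_id mulVf // gt_eqF.
have V0 : V != 0 by rewrite -normr_gt0 V1.
have [s1 [s2 [c [s10 s12 s21 c0 cP]]]] := field_nonzero_subarc arc ncol V0.
have [B B0 HB] := arc_bounded arc.
pose K := 2 * B + 1.
have K0 : 0 < K by rewrite addr_gt0 // mulr_gt0.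
have KP (G : affine_field R) z : gamma z -> `|fev G z| <= K * `|G|.
  move=> gz; apply: (le_trans (fev_norm _ _)); rewrite ler_wpM2r // lerD2r ler_pM2l //.
  exact: HB.
pose m := Num.min eta 1 / 2.
have m0 : 0 < m by rewrite divr_gt0 // lt_min eta0 ltr01.
have m_eta : 2 * m <= eta by rewrite /m mulrC divfK ?pnatr_eq0 // ge_min lexx.
have m_1 : 2 * m <= 1 by rewrite /m mulrC divfK ?pnatr_eq0 // ge_min lexx orbT.
(* with this bound on [|A|] conjugation enlarges the displacement at least by the
   factor [1 / m] *)
pose eps := m * c / (4 * K).
have eps0 : 0 < eps by rewrite divr_gt0 // mulr_gt0.
have [A [b [A0 Aeps Sg]]] := self eps s1 s2 eps0 (ltW s10) s12 (ltW s21).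
have Sg' z : gamma z -> gamma (z *m A + b).
  move=> /Sg [v /= + <-]; rewrite in_itv /= => /andP[v1 v2].
  by apply: (arc_mem arc); apply/andP; split; lra.
have Au : A \in unitmx.
  apply/negPn/negP => Au; apply: ncol.
  exact: (singular_self_map_collinear arc sh A0 Au Sg').
have Sinj z z' : z *m A + b = z' *m A + b -> z = z'.
  by move=> /addIr E; rewrite -[z](mulmxK Au) E mulmxK.
have [||theta cth thP] :=
    @arc_lift R phi gamma (fun s => phi (clamp 0 1 s) *m A + b) arc.
- move=> s; apply: (@continuous_comp _ _ _ (fun s => phi (clamp 0 1 s)) (fev (A, b))).
    by apply: continuous_comp; [exact: continuous_clamp|exact: cphi].
  exact: continuous_fev.
- by move=> s; apply: Sg'; apply: (arc_mem arc); apply: clamp_itv.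
have thE s : 0 <= s <= 1 -> s1 <= theta s <= s2 /\ phi (theta s) = phi s *m A + b.
  move=> s01; have [t01 E] := thP s; rewrite clampE // in E; split=> //.
  have [v /= + vE] := Sg _ (arc_mem arc s01); rewrite in_itv /= => vs.
  have v01 : 0 <= v <= 1 by case/andP: vs => ? ?; apply/andP; split; lra.
  by rewrite (arc_inj arc t01 v01 (etrans E (esym vE))).
have ith : {in `[0, 1] &, injective theta}.
  move=> s t; rewrite !in_itv /= => s01 t01 E; apply: (arc_inj arc s01 t01).
  by apply: Sinj; have [_ <-] := thE _ s01; have [_ <-] := thE _ t01; rewrite E.
have [mu mu0 margin] := injective_inner_margin cth ith eta0.
have [eps1 eps10 near] := push_param_near arc mu0.
have s2' : 0 < 1 - s2 by rewrite subr_gt0.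
have [eps2 eps20 ini] := shifts_initial arc s2'.
pose C := 4 * `|A| * `|invmx A| + 2 * (2 * `|b| + 1) * `|invmx A| + 1.
have C0 : 0 < C by rewrite ltr_wpDl // addr_ge0 // !mulr_ge0 // addr_ge0 // mulr_ge0.
pose e := Num.min (Num.min eps1 eps2) (eta / C).
have e0 : 0 < e by rewrite !lt_min eps10 eps20 divr_gt0.
have [N NP] : exists N : nat, e^-1 < N%:R.
  by exists (Num.bound e^-1); apply: archi_boundP; rewrite invr_ge0 ltW.
have d0 : 0 < c / (2 * K) by rewrite divr_gt0 // mulr_gt0.
have [n Nn nV] := VP _ d0 N.
have [Fn shF nofix] := FP n.
have : `|F n| < e.
  apply: (lt_le_trans Fn); rewrite -[e]invrK lef_pV2 ?posrE ?invr_gt0 ?ltr0n //.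
  by apply: (le_trans (ltW NP)); rewrite ler_nat leqW.
rewrite !lt_min => /andP[/andP[F1 F2] F3].
have [_ [tau [tau01 taus ftau gf]]] := ini _ F2 shF.
pose U := conj_field A b (F n).
have [th0 E0] := thE 0 (itv01_0 R).
have g0 := arc_mem arc (itv01_0 R).
have lower : c / 2 * `|F n| <= `|fev (F n) (phi 0 *m A + b)|.
  have H1 := KP (`|F n|^-1 *: F n - V) _ (Sg' _ g0).
  have H2 : K * `|(`|F n|^-1 *: F n - V)| <= c / 2.
    rewrite mulrC -ler_pdivlMr // (le_trans (ltW nV)) // invfM mulrA.
    by [].
  have H3 := cP _ th0; rewrite E0 in H3.
  have := lerB_dist (fev V (phi 0 *m A + b)) (fev (`|F n|^-1 *: F n) (phi 0 *m A + b)).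
  rewrite distrC -fevB => H4.
  have H5 : c / 2 <= `|fev (`|F n|^-1 *: F n) (phi 0 *m A + b)| by lra.
  by move: H5; rewrite fevZ normrZ normfV normr_id [X in _ <= X -> _]mulrC ler_pdivlMr.
have FU : `|F n| <= m * `|U|.
  have H1 : `|fev (F n) (phi 0 *m A + b)| <= 2 * (K * `|U|) * eps.
    rewrite -conj_fieldE //; apply: (le_trans (mulmx2_norm _ _)).
    apply: ler_pM => //.
    by rewrite ler_pM2l //; exact: KP.
  have H2 : 2 * (K * `|U|) * eps = c / 2 * (m * `|U|).
    by rewrite /eps; field; rewrite gt_eqF.
  rewrite -(@ler_pM2l _ (c / 2)) ?divr_gt0 //; apply: (le_trans lower); rewrite -H2.
  exact: H1.
have U0 : 0 < `|U|.
  rewrite lt_neqAle normr_ge0 andbT eq_sym; apply/eqP => U0.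
  by have := Fpos n; rewrite ltNge (le_trans FU) // U0 mulr0.
exists U; split.
- rewrite U0 /=; apply: (@le_lt_trans _ _ (C * `|F n|)).
    apply: (le_trans (conj_field_norm _ _ _)); rewrite ler_wpM2r // lerDl //.
  by rewrite mulrC -ltr_pdivlMr.
- rewrite trace_conj_field //; apply: (le_trans (mxtrace2_norm _)).
  have := fst_norm_le (F n); have := normr_ge0 U; nra.
- rewrite det_conj_field //; apply: (le_trans (det2_norm _)).
  have H : `|(F n).1| <= m * `|U| := le_trans (fst_norm_le _) FU.
  have : `|(F n).1| ^+ 2 <= (m * `|U|) ^+ 2 by rewrite lerXn2r ?nnegrE // mulr_ge0 // ltW.
  have := sqr_ge0 `|U|; rewrite exprMn => HU HM.
  apply: (@le_trans _ _ (2 * m ^+ 2 * `|U| ^+ 2)); first by lra.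
  by rewrite ler_wpM2r // expr2; nra.
- move=> s es se; have s01 : 0 <= s <= 1 by apply/andP; split; lra.
  have [ths thsE] := thE s s01; have [ths1 ths2] := andP ths.
  have ths01 : 0 <= theta s <= 1 by apply/andP; split; lra.
  have gs : gamma (push (F n) (phi (theta s))) by apply: gf; apply/andP; split; lra.
  have [v v01 vE] := arc_memP arc gs.
  have vth := margin s v es se (near _ F1 _ _ ths01 v01 vE).
  have [s' s'01 s'E] := IVT_between ler01 cth vth.
  have [_ E'] := thE s' s'01.
  suff -> : push U (phi s) = phi s' by exact: (arc_mem arc s'01).
  by apply: Sinj; rewrite push_conj_field // -thsE -vE -s'E.
Qed.

(** * The limit field and its orbits *)

Lemma eq0_small (R : realType) (x K : R) :
  (forall e, 0 < e -> `|x| <= K * e) -> x = 0.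
Proof.
move=> H; apply/eqP; rewrite -normr_le0; apply/ler_addgt0Pr => e e0.
have K0 : 0 < `|K| + 1 by rewrite ltr_wpDl.
rewrite add0r; apply: (le_trans (H (e / (`|K| + 1)) _)); first by rewrite divr_gt0.
rewrite mulrCA ler_piMr ?(ltW e0) // ler_pdivrMr // mul1r.
by rewrite (le_trans (ler_norm _)) // lerDl.
Qed.

Lemma nilpotent2 (R : realType) (M : 'M[R]_2) :
  \tr M = 0 -> \det M = 0 -> M *m M = 0.
Proof.
rewrite mxtrace2 det2 => tr0 det0; apply/matrixP => i j; rewrite mulmx2E [RHS]mxE.
case: (ord2P i) => ->; case: (ord2P j) => ->.
- transitivity (M 0 0 * (M 0 0 + M 1 1) - (M 0 0 * M 1 1 - M 0 1 * M 1 0)); first by ring.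
  by rewrite tr0 det0 mulr0 subr0.
- by transitivity (M 0 1 * (M 0 0 + M 1 1)); [ring|rewrite tr0 mulr0].
- by transitivity (M 1 0 * (M 0 0 + M 1 1)); [ring|rewrite tr0 mulr0].
- transitivity (M 1 1 * (M 0 0 + M 1 1) - (M 0 0 * M 1 1 - M 0 1 * M 1 0)); first by ring.
  by rewrite tr0 det0 mulr0 subr0.
Qed.

Lemma det2_dist (R : realType) (M N : 'M[R]_2) : `|M| <= 1 -> `|N| <= 1 ->
  `|\det M - \det N| <= 4 * `|M - N|.
Proof.
move=> M1 N1; rewrite !det2.
have en i j : `|M i j| <= 1 by exact: le_trans (entry_le_norm _ _ _) M1.
have en' i j : `|N i j| <= 1 by exact: le_trans (entry_le_norm _ _ _) N1.
have ed i j : `|M i j - N i j| <= `|M - N|.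
  by have := entry_le_norm (M - N) i j; rewrite !mxE.
have pr i j k l : `|M i j * M k l - N i j * N k l| <= 2 * `|M - N|.
  have -> : M i j * M k l - N i j * N k l =
    M i j * (M k l - N k l) + (M i j - N i j) * N k l by ring.
  rewrite (le_trans (ler_normD _ _)) // !normrM mulr_natl mulr2n.
  apply: lerD; first by rewrite -[leRHS]mul1r; apply: ler_pM.
  by rewrite -[leRHS]mulr1; apply: ler_pM.
have -> : M 0 0 * M 1 1 - M 0 1 * M 1 0 - (N 0 0 * N 1 1 - N 0 1 * N 1 0) =
  (M 0 0 * M 1 1 - N 0 0 * N 1 1) - (M 0 1 * M 1 0 - N 0 1 * N 1 0) by ring.
rewrite (le_trans (ler_normB _ _)) //.
by have := pr 0 0 1 1; have := pr 0 1 1 0; lra.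
Qed.

Lemma renormalised_limit_field (R : realType) (phi : R -> 'rV[R]_2) (gamma : set 'rV[R]_2) :
  arc_on phi gamma -> small_shifts phi gamma -> small_self_maps phi gamma ->
  ~ collinear gamma -> exists W : affine_field R, [/\ `|W| = 1, W.1 *m W.1 = 0 &
    forall eta, 0 < eta -> exists U : affine_field R, [/\ 0 < `|U| < eta,
      `|(`|U|^-1 *: U - W)| < eta &
      forall s, eta <= s -> s <= 1 - eta -> gamma (push U (phi s))]].
Proof.
move=> arc sh self ncol.
have /choice[U UP] : forall k : nat, exists U : affine_field R,
    [/\ 0 < `|U| < k.+1%:R^-1, `|\tr U.1| <= k.+1%:R^-1 * `|U|,
      `|\det U.1| <= k.+1%:R^-1 * `|U| ^+ 2 &
      forall s, k.+1%:R^-1 <= s -> s <= 1 - k.+1%:R^-1 -> gamma (push U (phi s))].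
  by move=> k; apply: (renormalised_shift arc sh self ncol); rewrite invr_gt0 ltr0n.
pose N k := `|U k|^-1 *: U k.
have N1 k : `|N k| = 1.
  by have [/andP[H _] _ _ _] := UP k; rewrite normrZ normfV normr_id mulVf // gt_eqF.
have [W W1 WP] := field_cluster N1.
have WN eta : 0 < eta -> exists n, n.+1%:R^-1 < eta /\ `|N n - W| < eta.
  move=> eta0.
  have [m mP] : exists m : nat, eta^-1 < m%:R.
    by exists (Num.bound eta^-1); apply: archi_boundP; rewrite invr_ge0 ltW.
  have [n mn nW] := WP _ eta0 m; exists n; split=> //.
  rewrite -[eta]invrK ltf_pV2 ?posrE ?invr_gt0 ?ltr0n //.
  by apply: (lt_le_trans mP); rewrite ler_nat leqW.
exists W; split=> //.
  apply: nilpotent2.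
    apply: (@eq0_small _ _ 3) => e e0; have [n [n1 nW]] := WN e e0.
    have [/andP[U0 _] tr _ _] := UP n.
    have -> : \tr W.1 = \tr (N n).1 - \tr (N n - W).1.
      by rewrite -linearB /= opprB addrC subrK.
    rewrite (le_trans (ler_normB _ _)) //.
    have H1 : `|\tr (N n).1| <= e.
      rewrite /N /= linearZ /= normrM normfV normr_id mulrC ler_pdivrMr //.
      by rewrite (le_trans tr) // ler_pM2r // ltW.
    have := mxtrace2_norm (N n - W).1; have := fst_norm_le (N n - W).
    by lra.
  apply: (@eq0_small _ _ 5) => e e0; have [n [n1 nW]] := WN e e0.
  have [/andP[U0 _] _ dt _] := UP n.
  have -> : \det W.1 = \det (N n).1 - (\det (N n).1 - \det W.1) by rewrite subKr.
  rewrite (le_trans (ler_normB _ _)) //.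
  have H1 : `|\det (N n).1| <= e.
    rewrite /N /= detZ normrM normrX normfV normr_id exprVn mulrC ler_pdivrMr ?exprn_gt0 //.
    by rewrite (le_trans dt) // ler_wpM2r ?exprn_ge0 // ltW.
  have := @det2_dist _ (N n).1 W.1 _ _.
  have h1 := fst_norm_le (N n); rewrite N1 in h1.
  have h2 := fst_norm_le W; rewrite W1 in h2.
  move=> /(_ h1 h2); have := fst_norm_le (N n - W); rewrite [(N n - W).1]/=.
  by lra.
move=> eta eta0; have [n [n1 nW]] := WN _ eta0; have [/andP[U0 U1] _ _ UP'] := UP n.
exists (U n); split=> //; first by rewrite U0 (lt_trans U1).
move=> s es se; apply: UP'; first exact: le_trans (ltW n1) es.
by apply: (le_trans se); rewrite lerD2l lerN2 ltW.
Qed.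

(** Since the square of the linear part vanishes, the quadratic curve in the
    conclusion is the exact orbit of [W] through [phi s0]. The iterates of the
    shifts [push U] are Euler steps for it, with step [|U|], and they stay on the
    arc as long as they stay near [phi s0]. *)
Lemma arc_contains_orbit (R : realType) (phi : R -> 'rV[R]_2) (gamma : set 'rV[R]_2)
    (W : affine_field R) (s0 : R) :
  arc_on phi gamma -> `|W| = 1 -> W.1 *m W.1 = 0 ->
  (forall eta, 0 < eta -> exists U : affine_field R, [/\ 0 < `|U| < eta,
      `|(`|U|^-1 *: U - W)| < eta &
      forall s, eta <= s -> s <= 1 - eta -> gamma (push U (phi s))]) ->
  0 < s0 < 1 -> exists2 tau, 0 < tau & forall t, 0 <= t <= tau ->
    gamma (phi s0 + t *: fev W (phi s0) + t ^+ 2 *: (2^-1 *: (fev W (phi s0) *m W.1))).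
Proof.
move=> arc W1 WW HU /andP[s00 s01].
set q := phi s0; pose w := fev W q; pose a := w *m W.1.
pose m := Num.min s0 (1 - s0) / 2.
have m0 : 0 < m by rewrite divr_gt0 // lt_min s00 subr_gt0.
have m_s0 : 2 * m <= s0 by rewrite /m mulrC divfK ?pnatr_eq0 // ge_min lexx.
have m_s1 : 2 * m <= 1 - s0 by rewrite /m mulrC divfK ?pnatr_eq0 // ge_min lexx orbT.
have [rho rho0 inv] := arc_inv_unif arc m0.
(* a bound for unit fields on the unit ball about [q] *)
pose B := 2 * (`|q| + 1) + 1.
have B3 : 3 <= B by have := normr_ge0 q; rewrite /B; lra.
pose r := Num.min rho 1.
have r0 : 0 < r by rewrite lt_min rho0 ltr01.
have r1 : r <= 1 by rewrite ge_min lexx orbT.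
have rrho : r <= rho by rewrite ge_min lexx.
have Bev (G : affine_field R) x : `|x - q| < r -> `|fev G x| <= B * `|G|.
  move=> xq; apply: (le_trans (fev_norm _ _)); rewrite ler_wpM2r // lerD2r ler_pM2l //.
  have := ler_normD (x - q) q; rewrite subrK; lra.
have qq : `|q - q| < r by rewrite subrr normr0.
have wB : `|w| <= B by have := Bev W q qq; rewrite W1 mulr1.
have M1 : `|W.1| <= 1 by rewrite -W1 fst_norm_le.
have aB : `|a| <= 2 * B.
  by rewrite (le_trans (mulmx2_norm _ _)) // -[leRHS]mulr1 ler_pM // ler_pM2l.
pose flow t := q + t *: w + t ^+ 2 *: (2^-1 *: a).
have flowW t : fev W (flow t) = w + t *: a.
  rewrite /flow /fev !mulmxDl -!scalemxAl /a -[w *m W.1 *m W.1]mulmxA WW mulmx0 !scaler0 addr0.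
  by rewrite addrAC.
have flowD t d : flow (t + d) = flow t + d *: fev W (flow t) + (d ^+ 2 / 2) *: a.
  by rewrite flowW /flow; apply/rowP => i; rewrite !mxE; field.
(* within this time the iterates travel at most [r / 4], and the Lipschitz
   constant 2 of [W] no more than doubles the accumulated error *)
pose tau := r / (4 * B).
have B0 : 0 < B by lra.
have tau0 : 0 < tau by rewrite divr_gt0 // mulr_gt0.
have tauB : 4 * tau * B = r by rewrite /tau; field; rewrite gt_eqF.
have tau4 : 4 * tau <= 1 by nra.
exists tau => // t /andP[t0 tt]; apply: (arc_closed arc) => e e0.
pose eta := Num.min m (e / (8 * B)).
have eta0 : 0 < eta by rewrite lt_min m0 divr_gt0 // mulr_gt0.
have etam : eta <= m by rewrite ge_min lexx.
have etae : 8 * B * eta <= e.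
  by rewrite mulrC -ler_pdivlMr ?mulr_gt0 // ge_min lexx orbT.
have [U [/andP[d0 de] UW Ug]] := HU eta eta0.
set d := `|U| in d0 de UW; pose V := d^-1 *: U.
have V1 : `|V| = 1 by rewrite normrZ normfV normr_id mulVf // gt_eqF.
have pushV x : push U x = x + d *: fev V x.
  by rewrite /push -fevZ /V scalerA mulfV ?scale1r // gt_eqF.
(* error per unit of time: a bound for [V - W] plus the second-order term *)
pose kappa := B * eta + B * d.
have kappa0 : 0 <= kappa by rewrite addr_ge0 // mulr_ge0 // ltW.
pose x j := iter j (push U) q.
have step j : j%:R * d <= tau -> [/\ gamma (x j), `|x j - q| <= j%:R * d * B &
    `|x j - flow (j%:R * d)| <= 2 * (j%:R * d) * kappa].
  elim: j => [|j IH] jd.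
    split; first by apply: (arc_mem arc); rewrite !ltW.
      by rewrite subrr normr0 !mul0r.
    by rewrite mul0r /flow expr0n /= !scale0r !addr0 subrr normr0 mulr0 mul0r.
  have jE : j.+1%:R * d = j%:R * d + d by rewrite -natr1 mulrDl mul1r.
  have jd0 : 0 <= j%:R * d by rewrite mulr_ge0 // ltW.
  have [gx xq xf] := IH ltac:(lra).
  have xr : `|x j - q| < r.
    apply: (le_lt_trans xq); rewrite -tauB; apply: (@le_lt_trans _ _ (tau * B)).
      by rewrite ler_pM2r //; lra.
    by rewrite ltr_pM2r //; lra.
  have xS : x j.+1 = x j + d *: fev V (x j) by rewrite /x iterS pushV.
  have [s s01' sE] := arc_memP arc gx.
  split.
  - have -> : x j.+1 = push U (phi s) by rewrite sE.
    have s0' : 0 <= s0 <= 1 by rewrite !ltW.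
    have sr : `|phi s - phi s0| < rho by rewrite sE (lt_le_trans xr).
    have := inv s s0 s01' s0' sr; rewrite ltr_norml => /andP[H1 H2]; apply: Ug; lra.
  - rewrite xS addrAC (le_trans (ler_normD _ _)) // jE mulrDl lerD // normrZ gtr0_norm //.
    by rewrite ler_pM2l //; have := Bev V _ xr; rewrite V1 mulr1.
  - have fr : `|fev W (x j) - fev W (flow (j%:R * d))| <= 2 * `|x j - flow (j%:R * d)|.
      rewrite fev_sub (le_trans (mulmx2_norm _ _)) // ler_piMr // mulr_ge0 //.
    rewrite jE flowD xS.
    have -> : x j + d *: fev V (x j) - (flow (j%:R * d) + d *: fev W (flow (j%:R * d)) + (d ^+ 2 / 2) *: a) =
       (x j - flow (j%:R * d)) + d *: fev (V - W) (x j)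
       + d *: (fev W (x j) - fev W (flow (j%:R * d))) - (d ^+ 2 / 2) *: a.
      by rewrite fevB; apply/rowP => i; rewrite !mxE; ring.
    have H1 : `|d *: fev (V - W) (x j)| <= d * (B * eta).
      rewrite normrZ gtr0_norm // ler_pM2l // (le_trans (Bev _ _ xr)) // ler_pM2l //.
      exact: ltW.
    have H2 : `|d *: (fev W (x j) - fev W (flow (j%:R * d)))| <= d * (2 * (2 * (j%:R * d) * kappa)).
      by rewrite normrZ gtr0_norm // ler_pM2l // (le_trans fr) // ler_pM2l.
    have H3 : `|(d ^+ 2 / 2) *: a| <= d * (B * d).
      rewrite normrZ ger0_norm ?divr_ge0 ?sqr_ge0 //.
      have -> : d * (B * d) = d ^+ 2 / 2 * (2 * B) by field.
      by rewrite ler_wpM2l // divr_ge0 ?sqr_ge0.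
    rewrite (le_trans (ler_normB _ _)) //.
    have H4 := ler_normD (x j - flow (j%:R * d) + d *: fev (V - W) (x j))
      (d *: (fev W (x j) - fev W (flow (j%:R * d)))).
    have H5 := ler_normD (x j - flow (j%:R * d)) (d *: fev (V - W) (x j)).
    have H6 : 4 * (j%:R * d) * (d * kappa) <= d * kappa.
      by rewrite ler_piMl ?mulr_ge0 // ?ltW //; lra.
    have H7 : d * kappa = d * (B * eta) + d * (B * d) by rewrite /kappa mulrDr.
    have H8 : d * (2 * (2 * (j%:R * d) * kappa)) = 4 * (j%:R * d) * (d * kappa) by ring.
    have H9 : 2 * (j%:R * d + d) * kappa = 2 * (j%:R * d) * kappa + 2 * (d * kappa) by ring.
    lra.
pose j := Num.trunc (t / d).
have /andP[j1 j2] : j%:R <= t / d < j.+1%:R by apply: truncn_itv; rewrite divr_ge0 // ltW.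
rewrite ler_pdivlMr // in j1; rewrite ltr_pdivrMr // -natr1 mulrDl mul1r in j2.
have jd0 : 0 <= j%:R * d by rewrite mulr_ge0 // ltW.
have [gx _ xf] := step j ltac:(lra).
exists (x j) => //.
rewrite -/w -/a -/(flow t) -[_ - _](subrKA (flow (j%:R * d))).
have K1 : `|flow t - flow (j%:R * d)| <= d * B + d * B.
  have -> : flow t - flow (j%:R * d) =
      (t - j%:R * d) *: w + ((t - j%:R * d) * ((t + j%:R * d) / 2)) *: a.
    by rewrite /flow; apply/rowP => i; rewrite !mxE; field.
  rewrite (le_trans (ler_normD _ _)) //; apply: lerD; rewrite normrZ.
    by apply: ler_pM => //; rewrite ger0_norm; lra.
  have -> : d * B = (d * 2^-1) * (2 * B) by field.
  apply: ler_pM => //; rewrite normrM; apply: ler_pM => //; rewrite ger0_norm; lra.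
have K2 : 2 * (j%:R * d) * kappa <= kappa.
  by rewrite ler_piMl //; lra.
have K3 : B * d < B * eta by rewrite ltr_pM2l.
rewrite distrC in xf; apply: (le_lt_trans (ler_normD _ _)).
have xf' := le_trans xf K2; rewrite /kappa in xf'; lra.
Qed.

(** Pointwise convergence at the origin and at the two basis vectors makes the
    coefficients of the displacement small. *)
Lemma affine_shifts_small (R : realType) (phi : R -> 'rV[R]_2) (gamma : set 'rV[R]_2)
    (f : nat -> 'rV[R]_2 -> 'rV[R]_2) :
  (forall k, affine_map (f k)) -> (forall x, f k x @[k --> \oo] --> x) ->
  (forall k, is_subarc gamma (f k (phi 0)) (phi 1) ((f k @` gamma) `&` gamma)) ->
  (forall k, fix_set (f k) `&` gamma = set0) -> small_shifts phi gamma.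
Proof.
move=> aff cvg sub nofix eps eps0.
have e0 : 0 < eps / 3 by rewrite divr_gt0.
have nearx x : \forall k \near \oo, `|x - f k x| < eps / 3.
  by have /cvgrPdist_lt := cvg x; apply.
have [k [k0 kd]] : exists k, `|0 - f k 0| < eps / 3 /\
    forall i, `|delta_mx 0 i - f k (delta_mx 0 i)| < eps / 3.
  have [N0 _ H0] := nearx 0.
  have [N1 _ H1] := nearx (delta_mx 0 0).
  have [N2 _ H2] := nearx (delta_mx 0 1).
  exists (maxn N0 (maxn N1 N2)); split; first by apply: H0; rewrite /= leq_maxl.
  move=> i; case: (ord2P i) => ->; [apply: H1|apply: H2];
    by rewrite /= !leq_max leqnn !orbT.
have [A [b fE]] := aff k.
pose F : affine_field R := (A - 1%:M, b).
have pE : push F = f k.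
  by apply/funext => z; rewrite pushE /= [1%:M + _]addrC subrK fE.
have f0 : f k 0 = b by rewrite fE mul0mx add0r.
have b_small : `|b| < eps / 3 by move: k0; rewrite f0 sub0r normrN.
exists F; split.
- apply: (@le_lt_trans _ _ (eps / 3 + eps / 3)); last by lra.
  rewrite field_norm_le; apply/andP; split; last by rewrite /=; lra.
  apply: norm_le_entries => [|i j]; first lra.
  have -> : F.1 i j = ((f k (delta_mx 0 i) - delta_mx 0 i) - b) 0 j.
    by rewrite fE -rowE !mxE eqxx /=; rewrite eq_sym; ring.
  rewrite (le_trans (entry_le_norm _ _ _)) // (le_trans (ler_normB _ _)) //.
  by have := kd i; rewrite distrC; lra.
- by rewrite /shifts pE.
- move=> z gz Fz; have : (fix_set (f k) `&` gamma) z.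
    by split=> //; rewrite /fix_set /= -pE /push Fz addr0.
  by rewrite nofix.
Qed.

Lemma Lip_norm_bound (R : realType) (S : 'rV[R]_2 -> 'rV[R]_2) (A : 'M[R]_2) b eps :
  (forall x, S x = x *m A + b) -> 0 <= eps -> (Lip S < eps%:E)%E -> `|A| <= eps.
Proof.
move=> SE eps0 L; apply: norm_le_entries => // i j.
pose p : 'rV[R]_2 * 'rV[R]_2 := (delta_mx 0 i, 0).
have pn : p.1 <> p.2.
  by move=> /rowP /(_ i) /eqP; rewrite !mxE !eqxx oner_eq0.
have Sp : S p.1 - S p.2 = row i A.
  by rewrite !SE /= mul0mx add0r addrK -rowE.
have np : enorm (p.1 - p.2) = 1.
  by rewrite /= subr0 enormE /dot !mxE; case: (ord2P i) => -> /=;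
    rewrite ?mulr1 ?mulr0 ?mul0r ?addr0 ?add0r sqrtr1.
have H : ((enorm (row i A))%:E <= Lip S)%E.
  by apply: ereal_sup_ubound; exists p => //; rewrite Sp np divr1.
have {}H : enorm (row i A) < eps by rewrite -lte_fin; exact: le_lt_trans H L.
apply: (le_trans _ (ltW H)); rewrite enormE -[leLHS]normr_id -sqrtr_sqr ler_wsqrtr //.
rewrite /dot !mxE real_normK ?num_real // -!expr2.
by case: (ord2P j) => ->; rewrite ?lerDl ?lerDr sqr_ge0.
Qed.

(** * The theorem *)

Lemma parabolic_of_self_maps (R : realType) (phi : R -> 'rV[R]_2) (gamma : set 'rV[R]_2) :
  arc_on phi gamma -> small_shifts phi gamma -> small_self_maps phi gamma ->
  parabolic_segment gamma.
Proof.
move=> arc sh self.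
have [col|ncol] := pselect (collinear gamma).
  by right; exact: collinear_arc_segment arc col.
have [W [W1 WW HU]] := renormalised_limit_field arc sh self ncol.
have W0 : W != 0 by rewrite -normr_gt0 W1.
have [s1 [s2 [c [s10 s12 s21 c0 cP]]]] := field_nonzero_subarc arc ncol W0.
have s1I : 0 < s1 < 1 by rewrite s10 (lt_trans s12).
have [tau tau0 orb] := arc_contains_orbit arc W1 WW HU s1I.
set q := phi s1 in orb; pose w := fev W q; pose a := 2^-1 *: (w *m W.1).
have w0 : w != 0.
  rewrite -normr_gt0; apply: (lt_le_trans c0); apply: cP.
  by rewrite lexx ltW.
pose h t := q + t *: w + t ^+ 2 *: a.
have ch : continuous h.
  move=> t; apply: (@cvgD R 'rV[R]_2 _ (nbhs t) _ (fun t => q + t *: w) (fun t => t ^+ 2 *: a)).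
    apply: (@cvgD R 'rV[R]_2 _ (nbhs t) _ (fun=> q) (fun t => t *: w)); first exact: cvg_cst.
    by apply: cvgZr_tmp; exact: cvg_id.
  by apply: cvgZr_tmp; exact: exprn_continuous.
have I0 : 0 <= (0 : R) <= tau by rewrite lexx ltW.
have It : 0 <= tau <= tau by rewrite lexx ltW.
have [s s01 sE] := arc_memP arc (orb 0 I0); have [t t01 tE] := arc_memP arc (orb tau It).
(* apply the nilpotent linear part to the equality of the two ends *)
have hne : h 0 != h tau.
  apply/eqP; rewrite /h expr0n /= !scale0r !addr0 -[LHS]addr0 -addrA => /addrI/esym E.
  have aM : a *m W.1 = 0 by rewrite /a -scalemxAl -mulmxA WW mulmx0 scaler0.
  have wM : w *m W.1 = 0.
    have : tau *: (w *m W.1) + tau ^+ 2 *: (a *m W.1) = 0.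
      by rewrite !scalemxAl -mulmxDl E mul0mx.
    rewrite aM scaler0 addr0 => /eqP.
    by rewrite scaler_eq0 gt_eqF //= => /eqP.
  move/eqP: E; rewrite /a wM !scaler0 addr0 scaler_eq0 gt_eqF //=.
  exact/negP.
have st : s != t by apply: contra hne => /eqP st; rewrite /h -sE -tE st.
have onh v : (s <= v <= t) || (t <= v <= s) -> exists u, phi v = h u.
  move=> sv.
  have [|u _ uE] := @arc_IVT R phi gamma h 0 tau s t v arc ch (ltW tau0) _ s01 t01 sE tE sv.
    exact: orb.
  by exists u.
have [A [b [A0 Sg SH]]] : exists (A : 'M[R]_2) (b : 'rV[R]_2), [/\ A != 0,
    forall z, gamma z -> gamma (z *m A + b) &
    forall z, gamma z -> exists u, z *m A + b = h u].
  have [s0 s1'] := andP s01; have [t0 t1] := andP t01.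
  case: (ltgtP s t) st => // st _.
    have [A [b [A0 _ H]]] := self 1 s t ltr01 s0 st t1.
    exists A, b; split=> // z /H [v /= + <-]; rewrite in_itv /= => vst.
      by apply: (arc_mem arc); case/andP: vst => ? ?; apply/andP; split; lra.
    by apply: onh; rewrite vst.
  have [A [b [A0 _ H]]] := self 1 t s ltr01 t0 st s1'.
  exists A, b; split=> // z /H [v /= + <-]; rewrite in_itv /= => vst.
    by apply: (arc_mem arc); case/andP: vst => ? ?; apply/andP; split; lra.
  by apply: onh; rewrite vst orbT.
have Au : A \in unitmx.
  apply/negPn/negP => Au; apply: ncol.
  exact: (singular_self_map_collinear arc sh A0 Au Sg).
apply: (@quadratic_curve_parabolic R phi gamma ((q - b) *m invmx A) (w *m invmx A) (a *m invmx A) arc).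
  by apply: contra w0 => /eqP E; rewrite -[w](mulmxKV Au) E mul0mx.
move=> z /SH [u uE]; exists u.
rewrite !scalemxAl -!mulmxDl -[LHS](mulmxK Au) -[z *m A](addrK b) uE /h.
by congr (_ *m _); rewrite addrAC (addrAC q).
Qed.

Theorem theorem2 (R : realType) (gamma : set 'rV[R]_2) (a0 a1 : 'rV[R]_2)
    (Hgamma : jordan_arc gamma a0 a1)
    (Hi : forall eps : R, 0 < eps ->
      forall (x y : 'rV[R]_2) (gamma' : set 'rV[R]_2),
        is_subarc gamma x y gamma' -> x <> y ->
        exists S : 'rV[R]_2 -> 'rV[R]_2,
          [/\ affine_map S, nonconstant S, S @` gamma `<=` gamma'
            & (Lip S < eps%:E)%E])
    (Hii : exists f : nat -> 'rV[R]_2 -> 'rV[R]_2,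
      [/\ forall k, affine_map (f k),
          forall x, f k x @[k --> \oo] --> x,
          forall k, is_subarc gamma (f k a0) a1 ((f k @` gamma) `&` gamma)
        & forall k, fix_set (f k) `&` gamma = set0]) :
  parabolic_segment gamma.
Proof.
have [phi0 [par0 E0 E1]] := Hgamma.
have [phi arc pE] := arc_param_on par0.
have p0 : phi 0 = a0 by rewrite pE ?itv01_0.
have p1 : phi 1 = a1 by rewrite pE ?itv01_1.
apply: (parabolic_of_self_maps arc).
  have [f [aff cvg sub nofix]] := Hii.
  by apply: (affine_shifts_small aff cvg _ nofix) => k; rewrite p0 p1.
move=> eps s t eps0 s0 st t1.
have sub : is_subarc gamma (phi s) (phi t) (phi @` `[s, t]).
  by exists phi, s, t; split=> //; [exact: arc_on_param|rewrite s0 ltW].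
have pst : phi s <> phi t.
  move=> E; suff stE : s = t by rewrite stE ltxx in st.
  by apply: (arc_inj arc) E; apply/andP; split; lra.
have [S [[A [b SE]] ncst Sg LS]] := Hi eps eps0 _ _ _ sub pst.
exists A, b; split.
- apply/eqP => A0; have [x [y]] := ncst; apply.
  by rewrite !SE A0 !mulmx0.
- exact: Lip_norm_bound SE (ltW eps0) LS.
- by move=> z gz; rewrite -SE; apply: Sg; exists z.
Qed.
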